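(* Assume that $c(x,\cdot)\in C^1(\mathcal Y)$ for every $x$ and that $$\nabla\psi_\varepsilon^\nu(y)=-\int_{\mathcal X}\nabla_2c(x,y)\,\pi_\varepsilon^\nu(dx|y)$$ holds in the sense of weak derivatives, $\nu$-a.e. Let $\pi^\nu_\varepsilon$ and $\pi^\mu_\varepsilon$ be the unique optimizers of the entropic optimal transport problem for the pairs of marginals $(\rho,\nu)$ and $(\rho,\mu)$ respectively. If there exists $\Lambda>0$ such that $y\mapsto c(x,y)+\psi^\nu_\varepsilon(y)$ is $\Lambda$-semiconcave uniformly in $x\in\mathrm{supp}(\rho)$, then $$\mathscr H(\pi^\mu_\varepsilon|\pi^\nu_\varepsilon)\le \mathscr H(\mu|\nu)+\frac{\Lambda}{2\varepsilon}\,\mathbf W_2^2(\mu,\nu).$$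
   Context: $\mathcal X$ is a Polish space; $(\mathcal Y,\mathfrak g)$ is a (possibly unbounded) connected Riemannian manifold without boundary with Riemannian distance $\mathsf d$ (e.g. $\mathbb R^d$ with the Euclidean metric). $\rho\in\mathcal P(\mathcal X)$, $\nu,\mu\in\mathcal P(\mathcal Y)$ are probability measures, $c:\mathcal X\times\mathcal Y\to\mathbb R$ is a cost and $\varepsilon>0$. $\nabla_2$ denotes the gradient in the second variable. $\Pi(\cdot,\cdot)$ is the set of couplings and $\mathscr H(p|q)=\int\log\frac{dp}{dq}\,dp$ (equal to $+\infty$ if $p\not\ll q$) is the relative entropy. $\mathbf W_2^2(\mu,\nu)=\inf_{\pi\in\Pi(\mu,\nu)}\int\mathsf d(z,y)^2\,d\pi(z,y)$. The entropic optimal transport problem for marginals $(\rho,\nu)$ is $\inf_{\pi\in\Pi(\rho,\nu)}\int c\,d\pi+\varepsilon\mathscr H(\pi|\rho\otimes\nu)$. Throughout, the cost satisfies mild integrability conditions ensuring that (for each pair of marginals considered) the unique optimal plan $\pi^\nu_\varepsilon$ satisfies $$\frac{d\pi_\varepsilon^\nu}{d(\rho\otimes\nu)}(x,y)=\exp\Big(-\frac{c(x,y)+\varphi^\nu_\varepsilon(x)+\psi^\nu_\varepsilon(y)}{\varepsilon}\Big)\quad \rho\otimes\nu\text{-a.e.}$$ for some functions $\varphi^\nu_\varepsilon,\psi^\nu_\varepsilon$ (entropic potentials). They are extended everywhere, with values in $\mathbb R\cup\{+\infty\}$, so that the Schrödinger system holds everywhere: $\varphi^\nu_\varepsilon(x)=\varepsilon\log\int_{\mathcal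 Y}e^{-(c(x,y)+\psi^\nu_\varepsilon(y))/\varepsilon}\nu(dy)$ and $\psi^\nu_\varepsilon(y)=\varepsilon\log\int_{\mathcal X}e^{-(c(x,y)+\varphi^\nu_\varepsilon(x))/\varepsilon}\rho(dx)$. The conditional law is $\pi^\nu_\varepsilon(dx|y)=\exp\big(-\frac{c(x,y)+\varphi^\nu_\varepsilon(x)+\psi^\nu_\varepsilon(y)}{\varepsilon}\big)\rho(dx)$. Analogous notation is used with $\mu$ in place of $\nu$. A differentiable $f:\mathcal Y\to\mathbb R$ is $\Lambda$-semiconcave if for all $z,y\in\mathcal Y$ and any geodesic $(\gamma_t)_{t\in[0,1]}$ with $\gamma_0=y$, $\gamma_1=z$, $$f(z)-f(y)\le\langle\nabla f(y),\dot\gamma_0\rangle_{\mathfrak g}+\frac{\Lambda}{2}\mathsf d(z,y)^2 .$$ In the Euclidean setting, where geodesics are straight lines, this reads $f(z)-f(y)\le\langle\nabla f(y),z-y\rangle+\frac\Lambda2\mathsf d(z,y)^2$ for all $z,y\in\mathcal Y$.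
   Formalization: The formal theorem also assumes any two points of Y are joined by a minimizing geodesic (true if Y is complete), reading ''geodesic'' as minimizing; without it semiconcavity says nothing about unjoined points and the inequality fails, e.g. on a thin U-shaped planar domain. *)

(* Defs.v *)
From HB Require Import structures.
From mathcomp Require Import all_boot all_order all_algebra.
From mathcomp Require Import all_classical all_reals all_analysis measurable_realfun.

Set Implicit Arguments.
Unset Strict Implicit.
Unset Printing Implicit Defensive.

Import Order.TTheory GRing.Theory Num.Theory.
Import numFieldNormedType.Exports.

Local Open Scope classical_set_scope.
Local Open Scope ring_scope.

(** ** Differential calculus on open subsets of R^d *)

(* [U] is meant to be open and [V] finite-dimensional. *)
Fixpoint Cn_on (R : realType) (V W : normedModType R) (n : nat) (U : set V)
    (f : V -> W) : Prop :=
  match n with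
  | 0 => forall x, U x -> {for x, continuous f}
  | n.+1 => (forall x, U x -> differentiable f x) /\
            forall v, Cn_on n U (fun x => 'D_v f x)
  end.

Definition smooth_on (R : realType) (V W : normedModType R) (U : set V)
  (f : V -> W) := forall n, Cn_on n U f.

(* Integral over R^d against Lebesgue measure, written as an iterated integral;
   by Fubini-Tonelli it is the usual one for functions that are Borel and
   either nonnegative or integrable, the only ones it is used for. *)
Fixpoint lebesgue_int (R : realType) (d : nat) :
    ('rV[R]_d -> \bar R) -> \bar R :=
  match d with
  | 0 => fun F => F 0
  | n.+1 => fun F => (\int[lebesgue_measure]_t
      @lebesgue_int R n (fun v : 'rV[R]_n => F (row_mx (t%:M : 'rV[R]_1) v)))%E
  end.

Notation borel T := (g_sigma_algebraType (@open T)).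

Definition locally_integrable_on (R : realType) (d : nat) (U : set 'rV[R]_d)
    (u : 'rV[R]_d -> R) : Prop :=
  measurable_fun (U : set (borel 'rV[R]_d)) (u : borel 'rV[R]_d -> R) /\
  forall K, compact K -> K `<=` U ->
    (lebesgue_int (fun p => (`|u p| * \1_K p)%:E) < +oo)%E.

Definition test_function (R : realType) (d : nat) (U : set 'rV[R]_d)
    (eta : 'rV[R]_d -> R) : Prop :=
  smooth_on setT eta /\
  exists2 K, compact K & K `<=` U /\ forall p, ~ K p -> eta p = 0.

(* [w] is the weak [k]-th partial derivative of [u] on the open set [U] *)
Definition weak_partial (R : realType) (d : nat) (U : set 'rV[R]_d)
    (k : 'I_d) (u w : 'rV[R]_d -> R) : Prop :=
  [/\ locally_integrable_on U u, locally_integrable_on U w &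
   forall eta, test_function U eta ->
     lebesgue_int (fun p => (u p * 'D_(delta_mx 0 k) eta p)%:E) =
     (- lebesgue_int (fun p => (w p * eta p)%:E))%E].

(** ** Riemannian manifolds *)

Definition bilin (R : realType) (d : nat) (A : 'M[R]_d) (u v : 'rV[R]_d) : R :=
  (u *m A *m v^T) 0 0.

(* Smooth manifold without boundary modelled on R^d, given by an atlas
   [coord i : dom i -> R^d] with inverses [icoord i] (both with junk values
   outside [dom i], resp. [coord i @` dom i]), with a smooth metric tensor
   [metric i] in each chart. [chart_at y] is a preferred chart around [y]: it
   serves to represent tangent vectors at [y] by their components in R^d. *)
Record riemannian_manifold (R : realType) (d : nat) (Y : topologicalType) :=
  RiemannianManifold {
  chart_index : Type ;
  dom : chart_index -> set Y ;
  coord : chart_index -> Y -> 'rV[R]_d ;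
  icoord : chart_index -> 'rV[R]_d -> Y ;
  chart_at : Y -> chart_index ;
  metric : chart_index -> 'rV[R]_d -> 'M[R]_d ;
  manifold_hausdorff : hausdorff_space Y ;
  manifold_second_countable : @second_countable Y ;
  dom_open : forall i, open (dom i) ;
  img_open : forall i, open (coord i @` dom i) ;
  coordK : forall i y, dom i y -> icoord i (coord i y) = y ;
  coord_continuous : forall i y, dom i y -> {for y, continuous (coord i)} ;
  icoord_continuous : forall i y, dom i y ->
    {for coord i y, continuous (icoord i)} ;
  dom_chart_at : forall y, dom (chart_at y) y ;
  transition_smooth : forall i j,
    smooth_on (coord i @` (dom i `&` dom j)) (coord j \o icoord i) ;
  metric_smooth : forall i, smooth_on (coord i @` dom i) (metric i) ;
  metric_sym : forall i y, dom i y ->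
    (metric i (coord i y))^T = metric i (coord i y) ;
  metric_posdef : forall i y v, dom i y -> v != 0 ->
    0 < bilin (metric i (coord i y)) v v ;
  metric_transition : forall i j y u v, dom i y -> dom j y ->
    bilin (metric i (coord i y)) u v =
    bilin (metric j (coord j y))
      ('D_u (coord j \o icoord i) (coord i y))
      ('D_v (coord j \o icoord i) (coord i y)) }.

Section riemannian_geometry.
Context {R : realType} {d : nat} {Y : topologicalType}.
Variable M : riemannian_manifold R d Y.

(* components of vectors in [T_y Y] are taken in the chart [chart_at y] *)
Definition inner (y : Y) (u v : 'rV[R]_d) : R :=
  bilin (metric (chart_at M y) (coord (chart_at M y) y)) u v.

Definition C1 (f : Y -> R) : Prop :=
  forall i : chart_index M, Cn_on 1 (coord i @` dom i) (f \o icoord i).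

Definition mdifferentiable (f : Y -> R) (y : Y) : Prop :=
  differentiable (f \o icoord (chart_at M y)) (coord (chart_at M y) y).

Definition gradient (f : Y -> R) (y : Y) : 'rV[R]_d :=
  (\row_k 'D_(delta_mx 0 k) (f \o icoord (chart_at M y))
            (coord (chart_at M y) y))
  *m invmx (metric (chart_at M y) (coord (chart_at M y) y)).

(* components in the chart [i] of [v \in T_y Y] *)
Definition components_in (i : chart_index M) (y : Y) (v : 'rV[R]_d) : 'rV[R]_d :=
  'D_v (coord i \o icoord (chart_at M y)) (coord (chart_at M y) y).

(* In each chart, the weak partial derivatives of [f] are the covariant
   components [<G, e_k>] of the vector field [G]. *)
Definition is_weak_gradient (f : Y -> R) (G : Y -> 'rV[R]_d) : Prop :=
  forall (i : chart_index M) k, weak_partial (coord i @` dom i) k (f \o icoord i)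
    (fun p => bilin (metric i p)
       (components_in i (icoord i p) (G (icoord i p))) (delta_mx 0 k)).

Definition velocity (g : R -> Y) (t : R) : 'rV[R]_d :=
  derive1 (coord (chart_at M (g t)) \o g) t.

Definition C1_curve_at (g : R -> Y) (t : R) : Prop :=
  [/\ {for t, continuous g},
      \forall s \near t, derivable (coord (chart_at M (g t)) \o g) s 1 &
      {for t, continuous (derive1 (coord (chart_at M (g t)) \o g))}].

(* curves on [0, 1], required to be C^1 on a neighbourhood of each point of
   [0, 1] so that [velocity] makes sense at the end points *)
Definition C1_curve (g : R -> Y) : Prop :=
  forall t, 0 <= t <= 1 -> C1_curve_at g t.

Definition curve_length (g : R -> Y) : R :=
  \int[lebesgue_measure]_(t in `[0, 1])
    Num.sqrt (inner (g t) (velocity g t) (velocity g t)).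

(* C^1 and piecewise C^1 curves give the same infimum (slow down at corners) *)
Definition rdist (y z : Y) : R :=
  inf [set curve_length g | g in [set g | [/\ C1_curve g, g 0 = y & g 1 = z]]].

(* minimizing geodesics with constant speed, parametrized by [0, 1] *)
Definition is_geodesic (g : R -> Y) : Prop :=
  C1_curve g /\
  forall s t, 0 <= s <= 1 -> 0 <= t <= 1 ->
    rdist (g s) (g t) = `|t - s| * rdist (g 0) (g 1).

(* By Hopf-Rinow this holds when [Y] is connected and complete; it also holds,
   e.g., for convex open subsets of R^d. *)
Definition geodesic_manifold : Prop :=
  forall y z, exists g, [/\ is_geodesic g, g 0 = y & g 1 = z].

Definition semiconcave (Lambda : R) (f : Y -> R) : Prop :=
  (forall y, mdifferentiable f y) /\
  forall y z g, is_geodesic g -> g 0 = y -> g 1 = z ->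
    f z - f y <= inner y (gradient f y) (velocity g 0)
                 + Lambda / 2 * rdist z y ^+ 2.

Definition esemiconcave (Lambda : R) (f : Y -> \bar R) : Prop :=
  exists2 h : Y -> R, forall y, f y = (h y)%:E & semiconcave Lambda h.

End riemannian_geometry.

(** ** Measure-theoretic notions *)

Local Open Scope charge_scope.

Definition polish (R : realType) (T : topologicalType) : Prop :=
  (exists2 D : set T, countable D & dense D) /\
  exists dist : T -> T -> R,
    [/\ (forall x y, dist x y = 0 <-> x = y),
        (forall x y, dist x y = dist y x),
        (forall x y z, dist x z <= dist x y + dist y z),
        (forall x (A : set T),
           nbhs x A <-> exists2 e : R, 0 < e & [set y | dist x y < e] `<=` A) &
        (forall u : nat -> T,
           (forall e : R, 0 < e -> exists N, forall m n,
              (N <= m)%N -> (N <= n)%N -> dist (u m) (u n) < e) ->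
           exists l : T, u @ \oo --> l)].

Definition msupport (R : realType) (T : ptopologicalType)
    (P : probability (borel T) R) : set T :=
  [set x | forall U : set T, open U -> U x -> (0 < P U)%E].

Definition coupling (R : realType) d1 d2 (T1 : measurableType d1)
    (T2 : measurableType d2) (p : probability T1 R) (q : probability T2 R)
    (pi : probability (T1 * T2)%type R) : Prop :=
  (forall A, measurable A -> pi (A `*` setT) = p A) /\
  (forall B, measurable B -> pi (setT `*` B) = q B).

Definition rn_density (R : realType) dT (T : measurableType dT)
    (p q : probability T R) : T -> \bar R :=
  'd (charge_of_finite_measure p) '/d q.

Definition relative_entropy (R : realType) dT (T : measurableType dT)
    (p q : probability T R) : \bar R :=
  if `[< p `<< q >] then
    (\int[p]_x lne (rn_density p q x))%E
  else +oo%E.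

Definition wasserstein2_sq (R : realType) (d : nat) (Y : ptopologicalType)
    (M : riemannian_manifold R d Y) (mu nu : probability (borel Y) R) : \bar R :=
  ereal_inf [set (\int[pi]_zy (rdist M zy.1 zy.2 ^+ 2)%:E)%E
    | pi in [set pi : probability (borel Y * borel Y)%type R
            | coupling mu nu pi]].

(** ** Entropic optimal transport *)

Section entropic_transport.
Local Open Scope ereal_scope.
Context {R : realType} d1 d2 (X : measurableType d1) (Y : measurableType d2).
Implicit Types (c : X -> Y -> R) (eps : R) (rho : probability X R)
  (nu : probability Y R) (pi : probability (X * Y)%type R).

(* [\int c dpi + eps H(pi | rho (x) nu)], with [+oo - oo = +oo] *)
Definition eot_cost c eps rho nu pi : \bar R :=
  let pos := \int[pi]_xy (Num.max (c xy.1 xy.2) 0)%:E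
             + eps%:E * relative_entropy pi (rho \x nu) in
  let neg := \int[pi]_xy (Num.max (- c xy.1 xy.2) 0)%:E in
  if pos == +oo then +oo else pos - neg.

Definition unique_eot_plan c eps rho nu pi : Prop :=
  coupling rho nu pi /\
  forall pi' : probability (X * Y)%type R, coupling rho nu pi' ->
    eot_cost c eps rho nu pi <= eot_cost c eps rho nu pi' /\
    (eot_cost c eps rho nu pi' = eot_cost c eps rho nu pi ->
     forall A, measurable A -> pi' A = pi A).

(* [exp (- (c + phi + psi) / eps)]; it is the density of [pi(dx | y)] with
   respect to [rho] *)
Definition gibbs c eps (phi : X -> \bar R) (psi : Y -> \bar R) (x : X) (y : Y) :
    \bar R :=
  expeR (- (((c x y)%:E + phi x + psi y) * (eps^-1)%:E)).

Definition entropic_potentials c eps rho nu pi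
    (phi : X -> \bar R) (psi : Y -> \bar R) : Prop :=
  [/\ measurable_fun setT phi /\ measurable_fun setT psi,
      (forall x, phi x != -oo) /\ (forall y, psi y != -oo),
      pi `<< (rho \x nu) /\
      ae_eq (rho \x nu) setT (rn_density pi (rho \x nu))
        (fun xy => gibbs c eps phi psi xy.1 xy.2),
      (forall x, phi x = eps%:E *
         lne (\int[nu]_y expeR (- (((c x y)%:E + psi y) * (eps^-1)%:E)))) &
      (forall y, psi y = eps%:E *
         lne (\int[rho]_x expeR (- (((c x y)%:E + phi x) * (eps^-1)%:E))))].

End entropic_transport.

(* [nabla psi (y) = - \int nabla_2 c(x, y) pi(dx | y)] for nu-a.e. y, where
   [nabla psi] is the weak gradient [G] of [psi]. A weak gradient being defined
   up to a negligible set for the volume only, and [nu] being arbitrary, [G] is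
   required to be the usual gradient wherever [psi] is differentiable. *)
Definition weak_gradient_identity (R : realType) (d : nat)
    (X Y : ptopologicalType) (M : riemannian_manifold R d Y)
    (c : X -> Y -> R) (eps : R) (rho : probability (borel X) R)
    (nu : probability (borel Y) R) (phi : X -> \bar R) (psi : Y -> \bar R) :
    Prop :=
  exists G : Y -> 'rV[R]_d,
    [/\ is_weak_gradient M (fine \o psi) G,
        (forall y, psi y \is a fin_num -> mdifferentiable M (fine \o psi) y ->
           G y = gradient M (fine \o psi) y) &
        {ae nu, forall y, forall k : 'I_d,
           let dc := fun x => ((gradient M (c x) y 0 k)%:E
                       * @gibbs _ _ _ (borel X) (borel Y) c eps phi psi x y)%E in
           rho.-integrable setT dc /\
           (G y 0 k)%:E = (- \int[rho]_x dc x)%E}].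

(* Main.v *)
Require Import Defs.
From mathcomp Require Import all_boot all_order all_algebra.
From mathcomp Require Import all_classical all_reals all_analysis measurable_realfun.
From mathcomp Require Import ring lra.

Set Implicit Arguments.
Unset Strict Implicit.
Unset Printing Implicit Defensive.

Import Order.TTheory GRing.Theory Num.Theory.
Import numFieldNormedType.Exports.

Local Open Scope classical_set_scope.
Local Open Scope ring_scope.

(** Write [K_y(dx) = k(x,y) rho(dx)] for the conditional laws of the plan with
marginals [(rho, nu)], where [k = exp (- (c + phi + psi) / eps)], and let
[f = (phinu - phimu) / eps], [g = (psinu - psimu) / eps], so that the plan with
marginals [(rho, mu)] has density [exp (f(x) + g(z)) * k(x,z)] with respect to
[rho \x mu]. Its density with respect to the other plan is
[(dmu/dnu)(z) * exp (f(x) + g(z))], hence its relative entropy is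
[H(mu|nu)] plus the integral of [f(x) + g(z)], and it suffices to bound the
latter by [Lambda / (2 eps)] times the cost of any coupling [tau] of
[(mu, nu)].

For points [y] and [z], the Fenchel-Young inequality bounds the [K_y]-mean of
[f + g(z)] by [log int exp (f + g(z)) dK_z], which is zero, plus
[int log (k(x,y) / k(x,z)) K_y(dx)], the relative entropy of [K_y] with respect
to [K_z]. The logarithm is the increment from [y] to [z] of the semiconcave
function [(c(x,.) + psinu) / eps]. Its first order term along a geodesic is
linear in the gradient, and the gradient has [K_y]-mean zero: this is the
identity assumed on the gradient of [psinu]. The quadratic term
[Lambda / (2 eps) * d(z,y)^2] remains ([semiconcave_gap]). Integrating in
[(z,y)] against [tau] turns the left-hand side into the sum of the integrals of
[f] and [g], because averaging [K_y] over [nu] gives [rho].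

The potentials [f] and [g] need not be integrable separately. The inequality is
therefore proved for potentials clipped at level [n] ([integrated_gap]), where
[log int exp (f + g(z)) dK_z = 0] is replaced by the convergence of
[int exp (f_n + g_n) k d(rho \x mu)] to [1] ([cvg_exp_truncate]); the limit on
the left is taken with Fatou's lemma, the negative part of [f + g] being
integrable because negative parts of relative entropies always are
([potential_gap], [relative_entropy_potential_gap]).

The squared Riemannian distance is never shown to be measurable: it only occurs
in upper bounds of measurable functions, and the integral of an arbitrary
nonnegative function is a supremum over the simple functions below it. *)

(** * Densities and relative entropy *)

Definition has_density (R : realType) d (T : measurableType d)
    (p q : probability T R) (k : T -> R) : Prop :=
  [/\ measurable_fun setT k, (forall x, 0 <= k x) &
      forall A, measurable A -> p A = (\int[q]_(x in A) (k x)%:E)%E].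

Section density.
Local Open Scope ereal_scope.
Context (R : realType) d (T : measurableType d).
Implicit Types (p q : probability T R) (k : T -> R).

Lemma density_dominates p q k : has_density p q k -> p `<< q.
Proof.
move=> [mk k0 pk]; apply/null_content_dominatesP => A mA qA.
by rewrite pk// null_set_integral//; exact/measurable_funTS/measurable_EFinP.
Qed.

Lemma density_integrable p q k : has_density p q k ->
  q.-integrable setT (EFin \o k).
Proof.
move=> [mk k0 pk]; apply/integrableP; split; first exact/measurable_EFinP.
under eq_integral do rewrite /= ger0_norm//.
by rewrite -pk// probability_setT ltry.
Qed.

Lemma ge0_integral_density p q k (F : T -> \bar R) : has_density p q k ->
  measurable_fun setT F -> (forall x, 0 <= F x) ->
  \int[p]_x F x = \int[q]_x (F x * (k x)%:E).
Proof.
move=> pqk; have pq := density_dominates pqk; have ik := density_integrable pqk.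
case: pqk => mk k0 pk mF F0.
rewrite -(Radon_Nikodym_SigmaFinite.change_of_variables pq)//.
have mf := measurable_int _ (Radon_Nikodym_SigmaFinite.f_integrable pq).
apply: ge0_ae_eq_integral => //.
- exact: emeasurable_funM.
- by apply: emeasurable_funM => //; exact/measurable_EFinP.
- by move=> x _; rewrite mule_ge0// Radon_Nikodym_SigmaFinite.f_ge0.
- by move=> x _; rewrite mule_ge0// lee_fin.
- apply: ae_eqe_mul2l; apply: integral_ae_eq => //.
  + exact: Radon_Nikodym_SigmaFinite.f_integrable.
  + exact/measurable_EFinP.
  + move=> E _ mE; rewrite -Radon_Nikodym_SigmaFinite.f_integral//.
    exact: pk.
Qed.

End density.

Section density_entropy.
Local Open Scope ereal_scope.
Context (R : realType) d (T : measurableType d).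
Implicit Types (p q : probability T R) (k : T -> R).

Lemma dominates_ae p q (P : set T) : p `<< q ->
  {ae q, forall x, P x} -> {ae p, forall x, P x}.
Proof.
by move=> /null_content_dominatesP pq [N [mN N0 PN]]; exists N; split => //; exact: pq.
Qed.

Lemma dominates_has_density p q : p `<< q -> exists k, has_density p q k.
Proof.
move=> pq; exists (fine \o Radon_Nikodym_SigmaFinite.f p q).
have fineE x : (fine (Radon_Nikodym_SigmaFinite.f p q x))%:E =
    Radon_Nikodym_SigmaFinite.f p q x.
  by rewrite fineK// Radon_Nikodym_SigmaFinite.f_fin_num.
split.
- apply: measurableT_comp => //.
  exact: measurable_int (Radon_Nikodym_SigmaFinite.f_integrable pq).
- by move=> x; rewrite fine_ge0// Radon_Nikodym_SigmaFinite.f_ge0.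
- move=> A mA; under eq_integral do rewrite /= fineE.
  exact: Radon_Nikodym_SigmaFinite.f_integral.
Qed.

Lemma density_gt0 p q k : has_density p q k -> {ae p, forall x, (0 < k x)%R}.
Proof.
case=> mk k0 pk.
have mN : measurable [set x | (k x <= 0)%R].
  rewrite (_ : [set x | _] = k @^-1` `]-oo, 0%R]); last first.
    by apply/seteqP; split => x /=; rewrite in_itv.
  by rewrite -[X in measurable X]setTI; exact: mk.
exists [set x | (k x <= 0)%R]; split => //.
- rewrite pk// integral0_eq// => x /= kx0.
  by congr EFin; apply/eqP; rewrite eq_le kx0 k0.
- by move=> x /= /negP; rewrite -leNgt.
Qed.

Lemma density_ae_unique p q k : has_density p q k ->
  {ae q, forall x, rn_density p q x = (k x)%:E}.
Proof.
move=> pqk; have pq := density_dominates pqk; case: (pqk) => mk k0 pk.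
have : ae_eq q setT (rn_density p q) (EFin \o k).
  apply: integral_ae_eq => //.
  - exact: Radon_Nikodym_integrable.
  - exact/measurable_EFinP.
  - by move=> E _ mE; rewrite -Radon_Nikodym_integral//; exact: pk.
by apply: filterS => x /(_ Logic.I).
Qed.

Lemma measurable_lne_EFin (h : T -> R) : measurable_fun setT h ->
  measurable_fun setT (fun x => lne (h x)%:E).
Proof.
move=> mh; apply: measurable_fun_ifT => //.
- exact: measurable_fun_ler.
- by apply/measurable_EFinP; exact: (measurableT_comp (@measurable_ln R) mh).
Qed.

Lemma relative_entropy_density p q k : has_density p q k ->
  relative_entropy p q = \int[p]_x (ln (k x))%:E.
Proof.
move=> pqk; have pq := density_dominates pqk; case: (pqk) => mk k0 pk.
rewrite /relative_entropy asboolT//.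
have rn_fin x : rn_density p q x = (fine (rn_density p q x))%:E.
  by rewrite fineK//; exact: Radon_Nikodym_fin_num.
apply: ae_eq_integral => //.
- under eq_fun do rewrite rn_fin.
  apply: measurable_lne_EFin; apply: measurableT_comp => //.
  by apply: (measurable_int q); exact: Radon_Nikodym_integrable.
- by apply/measurable_EFinP; exact: (measurableT_comp (@measurable_ln R) mk).
- have := dominates_ae pq (density_ae_unique pqk).
  apply: filterS2 (density_gt0 pqk) => x kx0 /= rnx _.
  by rewrite rnx lne_EFin.
Qed.

(** Changing variables to [q] leaves the integrand [t * max (- ln t) 0] with
    [t = k x], which is at most [1] since [ln (1 / t) < 1 / t]. Thus the negative
    part of a relative entropy is always integrable. *)
Lemma integral_ln_density_neg p q k : has_density p q k ->
  \int[p]_x (Num.max (- ln (k x)) 0)%:E <= 1.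
Proof.
move=> pqk; case: (pqk) => mk k0 pk.
have mln : measurable_fun setT (fun x => Num.max (- ln (k x)) 0)%R.
  apply: measurable_maxr => //; apply: measurableT_comp => //.
  exact: (measurableT_comp (@measurable_ln R) mk).
rewrite (ge0_integral_density pqk); last 2 first.
- exact/measurable_EFinP.
- by move=> x; rewrite lee_fin le_max lexx orbT.
rewrite -(probability_setT q) -[leRHS]mul1e -integral_cst//.
apply: ge0_le_integral => //.
- by move=> x _; rewrite mule_ge0// lee_fin// le_max lexx orbT.
- by apply: emeasurable_funM; exact/measurable_EFinP.
move=> x _; rewrite -EFinM lee_fin.
have [->|kn0] := eqVneq (k x) 0%R; first by rewrite mulr0.
have kx0 : (0 < k x)%R by rewrite lt_neqAle eq_sym kn0 k0.
have lnk : (- ln (k x) < (k x)^-1)%R.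
  by rewrite -lnV ?posrE// ln_sublinear// invr_gt0.
rewrite -ler_pdivlMr// mul1r ge_max (ltW lnk) invr_ge0.
exact: ltW.
Qed.

Lemma integrable_ln_density p q k : has_density p q k ->
  relative_entropy p q < +oo -> p.-integrable setT (fun x => (ln (k x))%:E).
Proof.
move=> pqk; rewrite (relative_entropy_density pqk) integralE => Hoo.
have mln : measurable_fun setT (fun x => (ln (k x))%:E).
  apply/measurable_EFinP; apply: (measurableT_comp (@measurable_ln R)).
  by case: pqk.
have negE : \int[p]_x (fun x => (ln (k x))%:E)^\- x =
    \int[p]_x (Num.max (- ln (k x)) 0)%:E.
  by apply: eq_integral => x _; rewrite funenegE EFin_max.
have neg1 := integral_ln_density_neg pqk; rewrite -negE in neg1.
have neg_fin : \int[p]_x (fun x => (ln (k x))%:E)^\- x \is a fin_num.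
  rewrite ge0_fin_numE; last by apply: integral_ge0 => x _; exact: funeneg_ge0.
  by rewrite (le_lt_trans neg1)// ltry.
have pos_fin : \int[p]_x (fun x => (ln (k x))%:E)^\+ x < +oo.
  by move: Hoo; rewrite -(fineK neg_fin) lteBlDr// addye.
apply/integrableP; split => //.
rewrite -[X in integral _ _ X]/(abse \o (fun x => (ln (k x))%:E)) fune_abse.
rewrite ge0_integralD//=; [|exact: measurable_funepos|exact: measurable_funeneg].
by rewrite lte_add_pinfty// ltey_eq neg_fin.
Qed.

End density_entropy.

(** * Integrals of nonnegative functions that need not be measurable *)

Section integral_comparison.
Local Open Scope ereal_scope.
Context (R : realType) d (T : measurableType d) (mu : {measure set T -> \bar R}).

(** The integral is a supremum over simple functions, hence monotone without
    any measurability. *)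
Lemma ge0_le_integral_lower (f1 f2 : T -> \bar R) :
  (forall x, 0 <= f1 x) -> (forall x, f1 x <= f2 x) ->
  \int[mu]_x f1 x <= \int[mu]_x f2 x.
Proof.
move=> f10 f12; rewrite !ge0_integralTE//; last first.
  by move=> x; exact: le_trans (f10 x) (f12 x).
apply: ereal_sup_le => _ [h /= hf <-]; exists h => // x.
exact: le_trans (hf x) (f12 x).
Qed.

(** [D] is not assumed measurable: it is bounded below by the measurable
    function [maxe (a - b) 0], set to [0] on the exceptional null set. *)
Lemma ae_le_integral_lowerD (a b : T -> \bar R) (D : T -> R) :
  measurable_fun setT a -> measurable_fun setT b ->
  (forall x, 0 <= a x) -> (forall x, 0 <= b x) -> (forall x, (0 <= D x)%R) ->
  {ae mu, forall x, a x <= (D x)%:E + b x} ->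
  \int[mu]_x a x <= \int[mu]_x (D x)%:E + \int[mu]_x b x.
Proof.
move=> ma mb a0 b0 D0 [N [mN N0 abN]].
pose F x := if x \in N then 0 else maxe (a x - b x) 0.
have F0 x : 0 <= F x by rewrite /F; case: ifP => // _; rewrite le_max lexx orbT.
have mF : measurable_fun setT F.
  apply: measurable_fun_ifT => //.
    apply: (measurable_fun_bool true); rewrite setTI.
    rewrite (_ : _ @^-1` _ = N)//.
    by apply/seteqP; split => x /=; [exact: set_mem|exact: mem_set].
  by apply: measurable_maxe => //; exact: emeasurable_funB.
apply: (@le_trans _ _ (\int[mu]_x F x + \int[mu]_x b x)); last first.
  apply: leeD => //; apply: ge0_le_integral_lower => // x.
  rewrite /F; case: ifPn => [_|xN]; first by rewrite lee_fin.
  rewrite ge_max lee_fin D0 andbT.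
  have /= : a x <= (D x)%:E + b x.
    apply: contrapT => abx; move: xN; rewrite notin_setE; apply.
    exact: abN.
  have := b0 x; case: (b x) => [r| |] // _.
  - by rewrite leeBlDr.
  - by rewrite addeNy leNye.
rewrite -ge0_integralD//; apply: ae_ge0_le_integral => //.
- by move=> x _; exact: adde_ge0.
- exact: emeasurable_funD.
- exists N; split => // x /= axN; apply: contrapT => xN; apply: axN => _.
  rewrite /F memNset//.
  have := b0 x; case: (b x) => [r| |] // _.
  - by rewrite -leeBlDr// le_max lexx.
  - rewrite addey ?leey// -ltNye (lt_le_trans (ltNyr 0))// le_max lexx orbT//.
Qed.

End integral_comparison.

Section infimum.
Local Open Scope ereal_scope.
Context (R : realType).

Import HBNNSimple.

(** The linearity of the integral requires measurability; here [D] is arbitrary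
    and each simple function below [a * D] is rescaled instead. *)
Lemma le_integral_lowerZl d (T : measurableType d) (mu : {measure set T -> \bar R})
    (a : R) (D : T -> R) : (0 < a)%R -> (forall x, (0 <= D x)%R) ->
  \int[mu]_x (a * D x)%:E <= a%:E * \int[mu]_x (D x)%:E.
Proof.
move=> a0 D0; rewrite ge0_integralTE; last first.
  by move=> x; rewrite lee_fin mulr_ge0// ltW.
apply: ge_ereal_sup => _ [h /= hD <-].
rewrite (_ : sintegral mu h = \int[mu]_x (h x)%:E); last first.
  by rewrite integral_nnsfun// patch_setT.
have mh : measurable_fun setT (fun x => (a^-1 * h x)%:E).
  by apply/measurable_EFinP; exact: measurable_funM.
rewrite (eq_integral (fun x => a%:E * (a^-1 * h x)%:E)); last first.
  by move=> x _; rewrite -EFinM mulrA divff ?mul1r// gt_eqF.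
rewrite ge0_integralZl//; [|by move=> x _; rewrite lee_fin mulr_ge0// invr_ge0 ltW|exact: ltW].
apply: lee_wpmul2l; first by rewrite lee_fin ltW.
apply: ge0_le_integral_lower => x.
  by rewrite lee_fin mulr_ge0// invr_ge0 ltW.
rewrite lee_fin ler_pdivrMl//; exact: hD.
Qed.

Lemma le_add_mul_ereal_inf (a b : \bar R) (k : R) (S : set \bar R) :
  b \is a fin_num -> (0 < k)%R ->
  (forall s, S s -> a <= b + k%:E * s) -> a <= b + k%:E * ereal_inf S.
Proof.
move=> bfin k0 abS.
have kV : (k^-1)%:E * (a - b) <= ereal_inf S.
  apply: le_ereal_inf_tmp => s Ss; rewrite lee_pdivrMl// leeBlDl//.
  exact: abS.
by rewrite -leeBlDl// -lee_pdivrMl.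
Qed.

End infimum.

(** * Product measures and couplings *)

Section density_products.
Local Open Scope ereal_scope.
Context (R : realType).

Lemma density_quotient d (T : measurableType d) (p q l : probability T R)
    (j r : T -> R) :
  measurable_fun setT r -> (forall x, (0 <= r x)%R) ->
  has_density q l j -> has_density p l (fun x => r x * j x)%R ->
  has_density p q r.
Proof.
move=> mr r0 qlj [mrj rj0 prj]; split=> // A mA; rewrite prj//.
rewrite integral_mkcond [RHS]integral_mkcond.
rewrite (ge0_integral_density qlj); last 2 first.
- by apply/(measurable_restrictT _ mA).1; apply: measurable_funTS; exact/measurable_EFinP.
- by move=> x; apply: erestrict_ge0 => y _; rewrite lee_fin.
apply: eq_integral => x _; rewrite /patch; case: ifP => _; rewrite ?mul0e//.
Qed.

Lemma density_chain d (T : measurableType d) (p q l : probability T R)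
    (j r : T -> R) :
  has_density p q r -> has_density q l j ->
  has_density p l (fun x => r x * j x)%R.
Proof.
move=> [mr r0 pqr] qlj; have [mj j0 _] := qlj.
split=> [|x|A mA]; [exact: measurable_funM|exact: mulr_ge0|].
rewrite pqr// integral_mkcond [RHS]integral_mkcond.
rewrite (ge0_integral_density qlj); last 2 first.
- by apply/(measurable_restrictT _ mA).1; apply: measurable_funTS; exact/measurable_EFinP.
- by move=> x; apply: erestrict_ge0 => y _; rewrite lee_fin.
apply: eq_integral => x _; rewrite /patch; case: ifP => _; rewrite ?mul0e//.
Qed.

Context d1 d2 (X : measurableType d1) (Y : measurableType d2).

Lemma product_integral (rho : probability X R) (mu : probability Y R)
    (F : X * Y -> \bar R) :
  measurable_fun setT F -> (forall xy, 0 <= F xy) ->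
  \int[(rho \x mu : probability (X * Y)%type R)]_xy F xy =
  \int[mu]_y \int[rho]_x F (x, y).
Proof. by move=> mF F0; exact: fubini_tonelli2. Qed.

(** Tonelli, integrating [x] first: the density acts on the outer variable
    only. *)
Lemma product_density (rho : probability X R) (mu nu : probability Y R)
    (m : Y -> R) :
  has_density mu nu m ->
  has_density (rho \x mu) (rho \x nu) (fun xy => m xy.2).
Proof.
move=> munu; have [mm m0 _] := munu.
have mm2 : measurable_fun setT (fun xy : X * Y => m xy.2).
  exact: (measurableT_comp mm).
split=> // A mA.
have mA1 : measurable_fun setT (fun xy => (\1_A xy : R)%:E).
  by apply/measurable_EFinP.
transitivity (\int[(rho \x mu : probability (X * Y)%type R)]_xy (\1_A xy)%:E).
  by rewrite integral_indic// setIT.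
rewrite product_integral// (ge0_integral_density munu); last 2 first.
- exact: (@measurable_fun_fubini_tonelli_G _ _ _ _ _ rho
            (fun xy => (\1_A xy : R)%:E)).
- by move=> y; exact: integral_ge0.
rewrite [RHS]integral_mkcond product_integral; last 2 first.
- apply: (measurable_restrictT _ mA).1; apply: measurable_funTS.
  exact/measurable_EFinP.
- by move=> x; apply: erestrict_ge0 => y _; rewrite lee_fin.
apply: eq_integral => y _; rewrite -ge0_integralZr//; last 2 first.
- by apply: (measurableT_comp mA1); exact: pair2_measurable.
- by rewrite lee_fin.
apply: eq_integral => x _; rewrite patchE indicE.
by case: ifP => _; rewrite ?mul1e ?mul0e.
Qed.

Lemma coupling_integral1 (p : probability X R) (q : probability Y R)
    (pi : probability (X * Y)%type R) (F : X -> \bar R) :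
  coupling p q pi -> measurable_fun setT F -> (forall x, 0 <= F x) ->
  \int[pi]_xy F xy.1 = \int[p]_x F x.
Proof.
move=> [pi1 _] mF F0.
rewrite -[LHS](@ge0_integral_pushforward _ _ _ _ _ _ measurable_fst pi setT F)//.
apply: eq_measure_integral => A mA _; apply: etrans (pi1 _ mA).
rewrite /= /pushforward; congr (pi _).
by apply/seteqP; split => [x Ax|x []]//; split.
Qed.

Lemma coupling_integral2 (p : probability X R) (q : probability Y R)
    (pi : probability (X * Y)%type R) (F : Y -> \bar R) :
  coupling p q pi -> measurable_fun setT F -> (forall x, 0 <= F x) ->
  \int[pi]_xy F xy.2 = \int[q]_x F x.
Proof.
move=> [_ pi2] mF F0.
rewrite -[LHS](@ge0_integral_pushforward _ _ _ _ _ _ measurable_snd pi setT F)//.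
apply: eq_measure_integral => A mA _; apply: etrans (pi2 _ mA).
rewrite /= /pushforward; congr (pi _).
by apply/seteqP; split => [x Ax|x []]//; split.
Qed.

Lemma coupling_ae1 (p : probability X R) (q : probability Y R)
    (pi : probability (X * Y)%type R) (P : X -> Prop) :
  coupling p q pi -> {ae p, forall x, P x} -> {ae pi, forall xy, P xy.1}.
Proof.
move=> [pi1 _] [N [mN N0 PN]]; exists (N `*` setT); split.
- exact: measurableX.
- by rewrite pi1.
- by move=> x /= nP; split=> //; exact: PN.
Qed.

Lemma coupling_ae2 (p : probability X R) (q : probability Y R)
    (pi : probability (X * Y)%type R) (P : Y -> Prop) :
  coupling p q pi -> {ae q, forall x, P x} -> {ae pi, forall xy, P xy.2}.
Proof.
move=> [_ pi2] [N [mN N0 PN]]; exists (setT `*` N); split.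
- exact: measurableX.
- by rewrite pi2.
- by move=> x /= nP; split=> //; exact: PN.
Qed.

End density_products.

(** * Truncation and the Fenchel-Young inequality *)

Section truncation.
Context (R : realType).
Implicit Types (N a b t : R).

Definition truncate N t := Num.max (- N) (Num.min t N).

Lemma truncate_ge N t : - N <= truncate N t.
Proof. by rewrite le_max lexx. Qed.

Lemma truncate_id N t : `|t| <= N -> truncate N t = t.
Proof.
by rewrite ler_norml => /andP[Nt tN]; rewrite /truncate (min_idPl tN) (max_idPr Nt).
Qed.

Lemma truncate_cases N t : 0 <= N -> [\/ t <= - N /\ truncate N t = - N,
  - N <= t <= N /\ truncate N t = t | N <= t /\ truncate N t = N].
Proof.
move=> N0; rewrite /truncate; case: (leP t N) => tN; last first.
  by apply: Or33; split; [exact: ltW|rewrite (max_idPr _)//; lra].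
by case: (leP (- N) t) => Nt; [apply: Or32|apply: Or31]; split=> //; lra.
Qed.

Lemma truncateD_le N a b : 0 <= N ->
  truncate N a + truncate N b <= Num.max (a + b) 0.
Proof.
move=> N0; case: (leP (a + b) 0) => ab;
  case: (truncate_cases a N0) => -[? ->];
  case: (truncate_cases b N0) => -[? ->]; lra.
Qed.

Lemma truncateD_ge N a b : 0 <= N ->
  0 <= truncate N a + truncate N b + Num.max (- (a + b)) 0.
Proof.
move=> N0; case: (leP (- (a + b)) 0) => ab;
  case: (truncate_cases a N0) => -[? ->];
  case: (truncate_cases b N0) => -[? ->]; lra.
Qed.

Lemma measurable_truncate N d (T : measurableType d) (h : T -> R) :
  measurable_fun setT h -> measurable_fun setT (fun x => truncate N (h x)).
Proof. by move=> mh; apply: measurable_maxr => //; exact: measurable_minr. Qed.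

Lemma cvg_truncate t : truncate n%:R t @[n --> \oo] --> t.
Proof.
apply: cvg_near_cst; near=> n; rewrite truncate_id//.
by near: n; exact: nbhs_infty_ger.
Unshelve. all: by end_near. Qed.

(** Fenchel-Young inequality for the conjugate pair [t * ln t - t] and [expR],
    written with [t = k / k']. *)
Lemma young_entropy b k k' : 0 < k -> 0 < k' ->
  b * k + k <= ln (k / k') * k + expR b * k'.
Proof.
move=> k0 k'0; have := expR_ge1Dx (b - ln (k / k')).
rewrite expRB lnK ?posrE ?divr_gt0// -(ler_pM2r k0) invf_div.
rewrite (_ : expR b * (k' / k) * k = expR b * k'); last by field; lra.
by lra.
Qed.

End truncation.

Section gap.
Local Open Scope ereal_scope.
Context (R : realType) d (T : measurableType d).

(** [L] is integrable but signed, and the integral of [Q] may be infinite: its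
    negative part is moved to the left before comparing. *)
Lemma ae_le_integralD (mu : {measure set T -> \bar R}) (a L Q : T -> \bar R) :
  measurable_fun setT a -> measurable_fun setT Q ->
  (forall x, 0 <= a x) -> (forall x, 0 <= Q x) ->
  mu.-integrable setT L -> {ae mu, forall x, a x <= L x + Q x} ->
  \int[mu]_x a x <= \int[mu]_x L x + \int[mu]_x Q x.
Proof.
move=> ma mQ a0 Q0 iL aLQ; have mL := measurable_int _ iL.
have Lneg := integrable_neg_fin_num measurableT iL.
rewrite [X in X + _]integralE addeAC leeBrDr//.
have mLp := measurable_funepos mL; have mLn := measurable_funeneg mL.
rewrite -!ge0_integralD//; apply: ae_ge0_le_integral => //.
- by move=> x _; exact: adde_ge0.
- exact: emeasurable_funD.
- by move=> x _; exact: adde_ge0.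
- exact: emeasurable_funD.
have := integrable_ae measurableT iL.
apply: filterS2 aLQ => x aLQ /(_ Logic.I) Lx _.
rewrite -leeBrDr; last first.
  rewrite funenegE; case: (L x) Lx => // r _.
  by rewrite -EFinN -EFin_max.
rewrite addeAC; apply: le_trans aLQ _.
by rewrite [in leLHS](funeposneg L).
Qed.

(** If [k] and [k'] are the densities of [K] and [K'] with respect to [rho],
    this is the variational bound
    [int b dK + 1 <= H(K|K') + int exp b dK'], with [H(K|K') <= D]. The constant
    [N] makes the left integrand nonnegative, so that the right integral may be
    infinite. The slack [l], of zero mean under [K], is where the first order
    term of the semiconcavity inequality goes. *)
Lemma entropy_gap (rho : probability T R) (k k' b l : T -> R) (N D : R) :
  measurable_fun setT k -> measurable_fun setT k' -> measurable_fun setT b ->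
  (forall x, (0 < k x)%R) -> (forall x, (0 < k' x)%R) ->
  \int[rho]_x (k x)%:E = 1 ->
  (0 <= N)%R -> (forall x, (0 <= b x + N)%R) -> (0 <= D)%R ->
  rho.-integrable setT (fun x => (l x * k x)%:E) ->
  \int[rho]_x (l x * k x)%:E = 0 ->
  {ae rho, forall x, (ln (k x / k' x) <= l x + D)%R} ->
  \int[rho]_x ((b x + N) * k x)%:E + 1 <=
  D%:E + (N%:E + \int[rho]_x (expR (b x) * k' x)%:E).
Proof.
move=> mk mk' mb k0 k'0 k1 N0 bN D0 il l0 lnD.
have k0' x : (0 <= k x)%R by exact: ltW.
have mek' : measurable_fun setT (fun x => expR (b x) * k' x)%R.
  by apply: measurable_funM => //; exact: (measurableT_comp (@measurable_expR R)).
have mbk : measurable_fun setT (fun x => (b x + N) * k x)%R.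
  by apply: measurable_funM => //; exact: measurable_funD.
have ik c : (0 <= c)%R -> \int[rho]_x (c * k x)%:E = c%:E.
  move=> c0; under eq_integral do rewrite EFinM.
  rewrite ge0_integralZl ?k1 ?mule1//; first exact/measurable_EFinP.
  by move=> x _; rewrite lee_fin.
have m1 : measurable_fun setT (fun x => ((b x + N) * k x)%:E).
  exact/measurable_EFinP.
have m2 : measurable_fun setT (fun x => (k x)%:E) by exact/measurable_EFinP.
have m3 : measurable_fun setT (fun x => ((D + N) * k x)%:E).
  by apply/measurable_EFinP; exact: measurable_funM.
have m4 : measurable_fun setT (fun x => (expR (b x) * k' x)%:E).
  exact/measurable_EFinP.
have p1 x : 0 <= ((b x + N) * k x)%:E by rewrite lee_fin mulr_ge0.
have p2 x : 0 <= (k x)%:E by rewrite lee_fin.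
have p3 x : 0 <= ((D + N) * k x)%:E by rewrite lee_fin mulr_ge0// addr_ge0.
have p4 x : 0 <= (expR (b x) * k' x)%:E.
  by rewrite lee_fin mulr_ge0 ?expR_ge0// ltW.
rewrite -[X in _ + X <= _]k1 (addeA D%:E) -EFinD -ik ?addr_ge0//.
rewrite -[leLHS]ge0_integralD// -[leRHS]add0e -l0 -[X in _ <= _ + X]ge0_integralD//.
apply: ae_le_integralD => //.
- exact: emeasurable_funD.
- exact: emeasurable_funD.
- by move=> x; exact: adde_ge0.
- by move=> x; exact: adde_ge0.
apply: filterS lnD => x lnD; rewrite -!EFinD lee_fin.
have := young_entropy (b x) (k0 x) (k'0 x).
have : (ln (k x / k' x) * k x <= (l x + D) * k x)%R by rewrite ler_pM2r.
lra.
Qed.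

End gap.

(** * The integral of the potentials is bounded by a transport cost *)

Section fatou_bound.
Local Open Scope ereal_scope.
Context (R : realType) d (T : measurableType d) (mu : {measure set T -> \bar R}).

Lemma fatou_bound (F_ : (T -> \bar R)^nat) (F : T -> \bar R)
    (u : (\bar R)^nat) (l : \bar R) :
  (forall n, measurable_fun setT (F_ n)) -> (forall n x, 0 <= F_ n x) ->
  (forall x, F_ n x @[n --> \oo] --> F x) ->
  (forall n, \int[mu]_x F_ n x <= u n) -> u n @[n --> \oo] --> l ->
  \int[mu]_x F x <= l.
Proof.
move=> mF F0 FF Fu ul.
rewrite (eq_integral (fun x => limn_einf (F_^~ x))); last first.
  by move=> x _; rewrite (cvg_limn_einf_sup (FF x)).1.
apply: le_trans (fatou mu measurableT mF (fun n x _ => F0 n x)) _.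
rewrite limn_einf_lim -(cvg_lim (@ereal_hausdorff R) ul).
apply: lee_lim; [exact: is_cvg_einfs|by apply/cvg_ex; exists l|].
apply: nearW => n; apply: le_trans (Fu n).
by apply: ereal_inf_lbound; exists n => /=.
Qed.

End fatou_bound.

Lemma probability_integral_cst (R : realType) d (T : measurableType d)
    (P : probability T R) (r : \bar R) : (\int[P]__ r = r)%E.
Proof.
by rewrite -[RHS]mule1 -(probability_setT P); exact: integral_cst.
Qed.

Section potential_gap.
Local Open Scope ereal_scope.
Context (R : realType) d1 d2 (X : measurableType d1) (Y : measurableType d2).
Context (rho : probability X R) (nu mu : probability Y R).
Context (pinu pimu : probability (X * Y)%type R).
Context (tau : probability (Y * Y)%type R).
Context (k : X * Y -> R) (f : X -> R) (g : Y -> R) (D : Y -> Y -> R).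
Hypothesis k_gt0 : forall xy, (0 < k xy)%R.
Hypothesis pinu_density : has_density pinu (rho \x nu) k.
Hypothesis pimu_density :
  has_density pimu (rho \x mu) (fun xy => expR (f xy.1 + g xy.2) * k xy)%R.
Hypothesis mf : measurable_fun setT f.
Hypothesis mg : measurable_fun setT g.
Hypothesis pinu_coupling : coupling rho nu pinu.
Hypothesis pimu_coupling : coupling rho mu pimu.
Hypothesis tau_coupling : coupling mu nu tau.
Hypothesis mu_nu : mu `<< nu.
Hypothesis D_ge0 : forall z y, (0 <= D z y)%R.
Hypothesis D_gap : {ae nu, forall y, forall z, exists l : X -> R,
  [/\ rho.-integrable setT (fun x => (l x * k (x, y))%:E),
      \int[rho]_x (l x * k (x, y))%:E = 0 &
      {ae rho, forall x, (ln (k (x, y) / k (x, z)) <= l x + D z y)%R}]}.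

Let mk : measurable_fun setT k. Proof. by case: pinu_density. Qed.

Let mksec y : measurable_fun setT (fun x => k (x, y)).
Proof. by apply: (measurableT_comp mk); exact: pair2_measurable. Qed.

(** The conditional laws are probability measures because the second marginal
    of [pinu] is [nu]. *)
Lemma conditional_mass1 : {ae nu, forall y, \int[rho]_x (k (x, y))%:E = 1}.
Proof.
have mek : measurable_fun setT (fun xy => (k xy)%:E) by exact/measurable_EFinP.
have ek0 xy : 0 <= (k xy)%:E by rewrite lee_fin ltW.
have mG : measurable_fun setT (fun y => \int[rho]_x (k (x, y))%:E).
  exact: (@measurable_fun_fubini_tonelli_G _ _ _ _ _ rho (fun xy => (k xy)%:E)).
have GB B : measurable B -> \int[nu]_(y in B) \int[rho]_x (k (x, y))%:E = nu B.
  move=> mB; have mXB : measurable ([set: X] `*` B) by exact: measurableX.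
  case: pinu_density => _ _ pinuE.
  rewrite -(pinu_coupling.2 _ mB) pinuE//.
  rewrite integral_mkcond [RHS]integral_mkcond product_integral; last 2 first.
  - by apply: (measurable_restrictT _ mXB).1; exact: measurable_funTS.
  - by move=> xy; apply: erestrict_ge0.
  apply: eq_integral => y _; rewrite patchE; case: ifPn => yB.
    apply: eq_integral => x _; rewrite patchE ifT// inE; split => //.
    exact: set_mem.
  rewrite integral0_eq// => x _; rewrite patchE ifF//.
  apply/negP => /set_mem[_ /mem_set]; exact/negP.
have : ae_eq nu setT (fun y => \int[rho]_x (k (x, y))%:E) (cst 1).
  apply: integral_ae_eq => //.
    apply/integrableP; split=> //.
    under eq_integral do rewrite gee0_abs ?integral_ge0//.
    by rewrite GB// probability_setT ltry.
  by move=> E _ mE; rewrite GB// integral_cst// mul1e.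
by apply: filterS => y /(_ Logic.I).
Qed.

Let half1 n x : (0 <= truncate n%:R (f x) + n%:R)%R.
Proof. by have := truncate_ge n%:R (f x); lra. Qed.

Let half2 n y : (0 <= truncate n%:R (g y) + n%:R)%R.
Proof. by have := truncate_ge n%:R (g y); lra. Qed.

Let E n z := \int[rho]_x
  (expR (truncate n%:R (f x) + truncate n%:R (g z)) * k (x, z))%:E.

(** [entropy_gap] for [b = f_n + g_n(z)], shifted by [2 n] to be nonnegative. *)
Lemma truncated_gap n : {ae nu, forall y, forall z,
  (\int[rho]_x ((truncate n%:R (f x) + n%:R) * k (x, y))%:E) +
    ((truncate n%:R (g z) + n%:R)%:E + 1) <=
  (D z y)%:E + ((n%:R + n%:R)%:E + E n z)}.
Proof.
apply: filterS2 conditional_mass1 D_gap => y k1 Dy z.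
have [l [il l0 lnD]] := Dy z.
have n0 : (0 <= n%:R :> R)%R by [].
have mtf := measurable_truncate n%:R mf.
have := @entropy_gap R _ X rho (fun x => k (x, y)) (fun x => k (x, z))
  (fun x => truncate n%:R (f x) + truncate n%:R (g z))%R l (n%:R + n%:R) (D z y).
move=> /(_ (mksec y) (mksec z)) /(_ _ (fun x => k_gt0 _) (fun x => k_gt0 _) k1).
move=> /(_ _ _ _ (D_ge0 z y) il l0 lnD) gap.
apply: le_trans (gap _ _ _) => //.
- rewrite addeA leeD2r//.
  under [leRHS]eq_integral => x _.
    rewrite (_ : _ * _ = (truncate n%:R (f x) + n%:R) * k (x, y) +
      (truncate n%:R (g z) + n%:R) * k (x, y))%R; last by ring.
    rewrite EFinD [in X in _ + X]EFinM; over.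
  rewrite ge0_integralD//; last 4 first.
  + by move=> x _; rewrite lee_fin mulr_ge0// ltW.
  + by apply/measurable_EFinP; apply: measurable_funM => //; exact: measurable_funD.
  + by move=> x _; rewrite mule_ge0// lee_fin// ltW.
  + by apply: emeasurable_funM => //; exact/measurable_EFinP.
  rewrite ge0_integralZl//; last 3 first.
  + exact/measurable_EFinP.
  + by move=> x _; rewrite lee_fin ltW.
  + by rewrite lee_fin.
  by rewrite k1 mule1.
- exact: measurable_funD.
- by move=> x; have := half1 n x; have := half2 n z; lra.
Qed.

Let mtf n : measurable_fun setT (fun x => (truncate n%:R (f x) + n%:R)%:E).
Proof.
by apply/measurable_EFinP; apply: measurable_funD => //; exact: measurable_truncate.
Qed.

Let mtg n : measurable_fun setT (fun y => (truncate n%:R (g y) + n%:R)%:E).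
Proof.
by apply/measurable_EFinP; apply: measurable_funD => //; exact: measurable_truncate.
Qed.

Let mexp n : measurable_fun setT (fun xy =>
  (expR (truncate n%:R (f xy.1) + truncate n%:R (g xy.2)) * k xy)%:E).
Proof.
apply/measurable_EFinP; apply: measurable_funM => //.
apply: (measurableT_comp (@measurable_expR R)); apply: measurable_funD.
- by apply: measurable_truncate; exact: (measurableT_comp mf).
- by apply: measurable_truncate; exact: (measurableT_comp mg).
Qed.

Let exp_ge0 n xy :
  0 <= (expR (truncate n%:R (f xy.1) + truncate n%:R (g xy.2)) * k xy)%:E.
Proof. by rewrite lee_fin mulr_ge0 ?expR_ge0// ltW. Qed.

Let mE n : measurable_fun setT (E n).
Proof. exact: (@measurable_fun_fubini_tonelli_G _ _ _ _ _ rho _ (mexp n) (exp_ge0 n)). Qed.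

Let E_ge0 n z : 0 <= E n z.
Proof. by apply: integral_ge0 => x _; exact: (exp_ge0 n (x, z)). Qed.

Let U n y := \int[rho]_x ((truncate n%:R (f x) + n%:R) * k (x, y))%:E.

Let mUk n : measurable_fun setT
  (fun xy => ((truncate n%:R (f xy.1) + n%:R) * k xy)%:E).
Proof.
apply/measurable_EFinP; apply: measurable_funM => //; apply: measurable_funD => //.
by apply: measurable_truncate; exact: (measurableT_comp mf).
Qed.

Let Uk_ge0 n xy : 0 <= ((truncate n%:R (f xy.1) + n%:R) * k xy)%:E.
Proof. by rewrite lee_fin mulr_ge0// ltW. Qed.

Let mU n : measurable_fun setT (U n).
Proof. exact: (@measurable_fun_fubini_tonelli_G _ _ _ _ _ rho _ (mUk n) (Uk_ge0 n)). Qed.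

Let U_ge0 n z : 0 <= U n z.
Proof. by apply: integral_ge0 => x _; exact: (Uk_ge0 n (x, z)). Qed.

Let integralU n : \int[nu]_y U n y = \int[rho]_x (truncate n%:R (f x) + n%:R)%:E.
Proof.
have f0 x : 0 <= (truncate n%:R (f x) + n%:R)%:E by rewrite lee_fin.
rewrite -(coupling_integral1 pinu_coupling (mtf n) f0).
rewrite (ge0_integral_density pinu_density)//; last first.
  exact: (measurableT_comp (mtf n)).
under [RHS]eq_integral do rewrite -EFinM.
by rewrite product_integral.
Qed.

(** Integrating against [tau] decouples the two truncated potentials, and they
    can then be recombined under [pimu], which has the same first marginal as
    [pinu] and the same second marginal as the first one of [tau]. *)
Lemma integrated_gap n :
  \int[pimu]_xy ((truncate n%:R (f xy.1) + n%:R) +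
                 (truncate n%:R (g xy.2) + n%:R))%:E + 1 <=
  \int[tau]_zy (D zy.1 zy.2)%:E + ((n%:R + n%:R)%:E + \int[mu]_z E n z).
Proof.
have f0 x : 0 <= (truncate n%:R (f x) + n%:R)%:E by rewrite lee_fin.
have g0 y : 0 <= (truncate n%:R (g y) + n%:R)%:E by rewrite lee_fin.
have n0 : 0 <= (n%:R + n%:R : R)%:E by rewrite lee_fin.
have mtf1 : measurable_fun setT
    (fun xy : X * Y => (truncate n%:R (f xy.1) + n%:R)%:E).
  exact: (measurableT_comp (mtf n)).
have mtg2 : measurable_fun setT
    (fun xy : X * Y => (truncate n%:R (g xy.2) + n%:R)%:E).
  exact: (measurableT_comp (mtg n)).
have mtg1 : measurable_fun setT
    (fun zy : Y * Y => (truncate n%:R (g zy.1) + n%:R)%:E).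
  exact: (measurableT_comp (mtg n)).
have mE1 : measurable_fun setT (fun zy : Y * Y => E n zy.1).
  exact: (measurableT_comp (mE n)).
have mU2 : measurable_fun setT (fun zy : Y * Y => U n zy.2).
  exact: (measurableT_comp (mU n)).
under eq_integral do rewrite EFinD.
rewrite ge0_integralD//.
rewrite (coupling_integral1 pimu_coupling (mtf n) f0).
rewrite (coupling_integral2 pimu_coupling (mtg n) g0) -integralU.
rewrite -(coupling_integral1 tau_coupling (mtg n) g0).
rewrite -(coupling_integral2 tau_coupling (mU n) (U_ge0 n)).
rewrite -(coupling_integral1 tau_coupling (mE n) (E_ge0 n)).
have mg1 : measurable_fun setT
    (fun zy : Y * Y => (truncate n%:R (g zy.1) + n%:R)%:E + 1).
  exact: emeasurable_funD.
have g10 (zy : Y * Y) : 0 <= (truncate n%:R (g zy.1) + n%:R)%:E + 1.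
  by rewrite adde_ge0.
have g1E : \int[tau]_zy ((truncate n%:R (g zy.1) + n%:R)%:E + 1) =
    \int[tau]_zy (truncate n%:R (g zy.1) + n%:R)%:E + 1.
  by rewrite ge0_integralD// probability_integral_cst.
have -> : \int[tau]_zy U n zy.2 +
    \int[tau]_zy (truncate n%:R (g zy.1) + n%:R)%:E + 1 =
    \int[tau]_zy (U n zy.2 + ((truncate n%:R (g zy.1) + n%:R)%:E + 1)).
  rewrite (@ge0_integralD _ _ _ tau _ measurableT _ _ (fun zy _ => U_ge0 n zy.2)
    mU2 (fun zy _ => g10 zy) mg1).
  by rewrite g1E addeA.
have -> : (n%:R + n%:R)%:E + \int[tau]_zy E n zy.1 =
    \int[tau]_zy ((n%:R + n%:R)%:E + E n zy.1).
  rewrite (@ge0_integralD _ _ _ tau _ measurableT _ _ (fun _ _ => n0) _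
    (fun zy _ => E_ge0 n zy.1) mE1)//.
  by rewrite probability_integral_cst.
apply: ae_le_integral_lowerD => //.
- exact: emeasurable_funD.
- exact: emeasurable_funD.
- by move=> zy; exact: adde_ge0.
- by move=> zy; exact: adde_ge0.
by apply: filterS (coupling_ae2 tau_coupling (truncated_gap n)) => zy.
Qed.

Let prodmass : \int[mu]_y \int[rho]_x (k (x, y))%:E = 1.
Proof.
rewrite (ae_eq_integral (cst 1))//.
- exact: probability_integral_cst.
- apply: (@measurable_fun_fubini_tonelli_G _ _ _ _ _ rho (fun xy => (k xy)%:E)).
    exact/measurable_EFinP.
  by move=> xy; rewrite lee_fin ltW.
- by apply: filterS (dominates_ae mu_nu conditional_mass1) => y.
Qed.

(** The clipped exponential is at most [1 + exp (f + g)]; times [k] this is the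
    sum of two densities of total mass [1] with respect to [rho \x mu]. *)
Lemma cvg_exp_truncate : \int[mu]_z E n z @[n --> \oo] --> 1.
Proof.
have mek : measurable_fun setT (fun xy => (k xy)%:E) by exact/measurable_EFinP.
have ek0 xy : 0 <= (k xy)%:E by rewrite lee_fin ltW.
have [mkmu kmu0 kmuE] := pimu_density.
have mekmu : measurable_fun setT
    (fun xy => (expR (f xy.1 + g xy.2) * k xy)%:E) by exact/measurable_EFinP.
have ekmu0 xy : 0 <= (expR (f xy.1 + g xy.2) * k xy)%:E by rewrite lee_fin.
pose P : probability (X * Y)%type R := rho \x mu.
have EP n : \int[mu]_z E n z = \int[P]_xy
    (expR (truncate n%:R (f xy.1) + truncate n%:R (g xy.2)) * k xy)%:E.
  by rewrite product_integral.
under eq_cvg do rewrite EP.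
have lim1 : \int[P]_xy (expR (f xy.1 + g xy.2) * k xy)%:E = 1.
  by rewrite -kmuE// probability_setT.
have iP : P.-integrable setT
    (fun xy => (k xy)%:E + (expR (f xy.1 + g xy.2) * k xy)%:E).
  apply/integrableP; split; first exact: emeasurable_funD.
  under eq_integral do rewrite gee0_abs ?adde_ge0//.
  by rewrite ge0_integralD// lim1 product_integral// prodmass ltry.
have := @dominated_convergence _ _ _ P setT measurableT
  (fun n xy => (expR (truncate n%:R (f xy.1) + truncate n%:R (g xy.2)) * k xy)%:E)
  (fun xy => (expR (f xy.1 + g xy.2) * k xy)%:E)
  _ mexp mekmu _ iP _.
rewrite lim1 => -[||_ _] //.
- apply: nearW => -[x y] _ /=; apply: cvg_EFin; first exact: nearW.
  apply: cvgMl; apply: (@cvg_comp _ _ _ _ expR); last exact: continuous_expR.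
  by apply: cvgD; exact: cvg_truncate.
- apply: nearW => -[x y] n _ /=; rewrite ger0_norm; last by rewrite mulr_ge0 ?expR_ge0// ltW.
  rewrite -EFinD lee_fin -[X in (_ <= X + _)%R]mul1r -mulrDl ler_pM2r//.
  have := truncateD_le (f x) (g y) (ler0n R n).
  case: (leP (f x + g y)%R 0%R) => fg h.
  + rewrite (le_trans (_ : _ <= 1)%R) ?lerDl ?expR_ge0//.
    by rewrite -[leRHS]expR0 ler_expR.
  + by rewrite (le_trans (_ : _ <= expR (f x + g y))%R) ?lerDr// ler_expR.
Qed.

(** Fatou's lemma for [f_n + g_n + (f + g)^-], which is nonnegative and converges
    to [(f + g)^+]. *)
Lemma potential_gap :
  pimu.-integrable setT
    (fun xy => (Num.max (- (f xy.1 + g xy.2)) 0)%:E) ->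
  \int[pimu]_xy (Num.max (f xy.1 + g xy.2) 0)%:E <=
  \int[tau]_zy (D zy.1 zy.2)%:E +
  \int[pimu]_xy (Num.max (- (f xy.1 + g xy.2)) 0)%:E.
Proof.
set neg := (fun xy => _) => ineg; pose s xy := (f xy.1 + g xy.2)%R.
have neg0 xy : 0 <= neg xy by rewrite lee_fin le_max lexx orbT.
have mneg : measurable_fun setT neg := measurable_int _ ineg.
have negI0 : 0 <= \int[pimu]_xy neg xy.
  by apply: integral_ge0 => xy _; exact: neg0.
have [->|] := eqVneq (\int[tau]_zy (D zy.1 zy.2)%:E) +oo.
  by rewrite addye ?leey// -ltNye (lt_le_trans (ltNyr 0)).
rewrite -ltey => Doo.
have Dfin : \int[tau]_zy (D zy.1 zy.2)%:E \is a fin_num.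
  by rewrite ge0_fin_numE// integral_ge0// => zy _; rewrite lee_fin.
have negfin : \int[pimu]_xy neg xy \is a fin_num by exact: integrable_fin_num.
pose sn n (xy : X * Y) := (truncate n%:R (f xy.1) + truncate n%:R (g xy.2))%R.
have msn n : measurable_fun setT (sn n).
  apply: measurable_funD.
  - by apply: measurable_truncate; exact: (measurableT_comp mf).
  - by apply: measurable_truncate; exact: (measurableT_comp mg).
have msneg n : measurable_fun setT (fun xy => (sn n xy)%:E + neg xy).
  by apply: emeasurable_funD => //; exact/measurable_EFinP.
have sneg0 n xy : 0 <= (sn n xy)%:E + neg xy.
  by rewrite -EFinD lee_fin truncateD_ge.
(* the shift [2 n] of [integrated_gap] cancels on both sides *)
have sn_bound n : \int[pimu]_xy ((sn n xy)%:E + neg xy) <=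
    \int[tau]_zy (D zy.1 zy.2)%:E + \int[pimu]_xy neg xy - 1 +
    \int[mu]_z E n z.
  have n0 : 0 <= (n%:R + n%:R : R)%:E by rewrite lee_fin.
  have := integrated_gap n.
  have : \int[pimu]_xy ((sn n xy)%:E + neg xy) + (n%:R + n%:R)%:E =
    \int[pimu]_xy ((truncate n%:R (f xy.1) + n%:R) +
                 (truncate n%:R (g xy.2) + n%:R))%:E + \int[pimu]_xy neg xy.
    rewrite -[X in _ + X = _](probability_integral_cst pimu).
    rewrite -!ge0_integralD//.
    - apply: eq_integral => xy _; rewrite addeAC -(EFinD (sn n xy)); congr (_%:E + _).
      rewrite /sn; ring.
    - by move=> xy _; rewrite lee_fin addr_ge0.
    - apply/measurable_EFinP; apply: measurable_funD.
      + apply: measurable_funD => //.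
        by apply: measurable_truncate; exact: (measurableT_comp mf).
      + apply: measurable_funD => //.
        by apply: measurable_truncate; exact: (measurableT_comp mg).
  move: (\int[pimu]_xy ((sn n xy)%:E + neg xy)) => a.
  move: (\int[pimu]_xy _%:E) => b.
  have : 0 <= \int[mu]_z E n z by apply: integral_ge0.
  move: (\int[mu]_z E n z) => e.
  move: Dfin negfin; case: (\int[tau]_zy _) => // Dr _.
  case: (\int[pimu]_xy neg xy) => // Nr _.
  case: e => // [e _|_ _ _]; last by rewrite addey// leey.
  case: a => [a||]; [|by case: b|by rewrite leNye].
  case: b => [b|//|//]; rewrite -!EFinD !lee_fin => -[] ? ?.
  lra.
have mpos : measurable_fun setT (fun xy => (Num.max (s xy) 0)%:E).
  apply/measurable_EFinP; apply: measurable_maxr => //; apply: measurable_funD.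
  - exact: (measurableT_comp mf).
  - exact: (measurableT_comp mg).
apply: (fatou_bound msneg sneg0 _ sn_bound).
- move=> xy; rewrite (_ : (Num.max (s xy) 0)%:E = (s xy)%:E + neg xy).
    rewrite /neg -EFinD; apply: cvg_EFin; first exact: nearW.
    have : (truncate n%:R (f xy.1) + truncate n%:R (g xy.2) +
        Num.max (- s xy) 0)%R @[n --> \oo] -->
        (f xy.1 + g xy.2 + Num.max (- s xy) 0)%R.
      by apply: cvgD; [apply: cvgD; exact: cvg_truncate|exact: cvg_cst].
    exact.
  rewrite /neg -EFinD /s; congr EFin.
  by case: (leP (f xy.1 + g xy.2)%R 0%R); case: (leP (- _)%R 0%R); lra.
- have := cvg_exp_truncate.
  move: Dfin negfin; case: (\int[tau]_zy _) => // Dr _.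
  case: (\int[pimu]_xy neg xy) => // Nr _ E1.
  rewrite -[X in _ --> X](subeK (Dr%:E + Nr%:E) (y := 1))//.
  by apply: cvgeD => //; exact: cvg_cst.
Qed.

(** The density of [pimu] with respect to [pinu] is [r = m * exp s], with [m] the
    density of [mu] and [s = f + g]. Hence [s^- <= |ln m| + (ln r)^-] is
    integrable, and [ln r = ln m + s] can be integrated term by term. *)
Lemma relative_entropy_potential_gap :
  relative_entropy pimu pinu <=
  relative_entropy mu nu + \int[tau]_zy (D zy.1 zy.2)%:E.
Proof.
have ID0 : 0 <= \int[tau]_zy (D zy.1 zy.2)%:E.
  by apply: integral_ge0 => zy _; rewrite lee_fin.
have [m munu] := dominates_has_density mu_nu; have [mm m0 _] := munu.
have [Hoo|] := eqVneq (relative_entropy mu nu) +oo.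
  by rewrite Hoo addye ?leey// -ltNye (lt_le_trans (ltNyr 0)).
rewrite -ltey => Hoo; have ilnm := integrable_ln_density munu Hoo.
pose s xy := (f xy.1 + g xy.2)%R; pose r xy := (m xy.2 * expR (s xy))%R.
have ms : measurable_fun setT (s : X * Y -> R).
  by apply: measurable_funD; [exact: (measurableT_comp mf)|exact: (measurableT_comp mg)].
have mm2 : measurable_fun setT (fun xy : X * Y => m xy.2).
  exact: (measurableT_comp mm).
have mr : measurable_fun setT (r : X * Y -> R).
  by apply: measurable_funM => //; exact: (measurableT_comp (@measurable_expR R)).
have r0 xy : (0 <= r xy)%R by rewrite mulr_ge0 ?expR_ge0.
have pr : has_density pimu pinu r.
  apply: (density_quotient mr r0 pinu_density).
  have := density_chain pimu_density (product_density rho munu).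
  congr has_density; apply/funext => xy; rewrite /r /s; ring.
rewrite (relative_entropy_density pr) (relative_entropy_density munu).
have m2_gt0 : {ae pimu, forall xy, (0 < m xy.2)%R}.
  exact: coupling_ae2 pimu_coupling (density_gt0 munu).
have lnr xy : (0 < m xy.2)%R -> ln (r xy) = (ln (m xy.2) + s xy)%R.
  by move=> mxy; rewrite /r lnM ?posrE ?expR_gt0// expRK.
have mlnm : measurable_fun setT (fun y => (ln (m y))%:E).
  by apply/measurable_EFinP; exact: (measurableT_comp (@measurable_ln R)).
have mlnr : measurable_fun setT (fun xy => (ln (r xy))%:E).
  by apply/measurable_EFinP; exact: (measurableT_comp (@measurable_ln R)).
have ilnm2 : pimu.-integrable setT (fun xy => (ln (m xy.2))%:E).
  apply/integrableP; split; first exact: (measurableT_comp mlnm).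
  have [_] := integrableP _ _ _ ilnm.
  by rewrite (coupling_integral2 pimu_coupling (F := fun y => `|(ln (m y))%:E|))//; exact: measurableT_comp.
have ineglnr : pimu.-integrable setT (fun xy => (Num.max (- ln (r xy)) 0)%:E).
  apply/integrableP; split.
    apply/measurable_EFinP; apply: measurable_maxr => //.
    by apply: measurableT_comp => //; exact/measurable_EFinP.
  under eq_integral do rewrite gee0_abs ?lee_fin ?le_max ?lexx ?orbT//.
  by rewrite (le_lt_trans (integral_ln_density_neg pr))// ltry.
have ineg : pimu.-integrable setT (fun xy => (Num.max (- s xy) 0)%:E).
  apply/integrableP; split.
    by apply/measurable_EFinP; apply: measurable_maxr => //; exact: measurableT_comp.
  under eq_integral do rewrite gee0_abs ?lee_fin ?le_max ?lexx ?orbT//.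
  have iB := integrableD measurableT (integrable_abse ilnm2) ineglnr.
  have B0 xy : 0 <= `|(ln (m xy.2))%:E| + (Num.max (- ln (r xy)) 0)%:E.
    by rewrite adde_ge0// lee_fin le_max lexx orbT.
  apply: (@le_lt_trans _ _ (\int[pimu]_xy
      (`|(ln (m xy.2))%:E| + (Num.max (- ln (r xy)) 0)%:E))).
    apply: ae_ge0_le_integral => //.
    - by move=> xy _; rewrite lee_fin le_max lexx orbT.
    - by apply/measurable_EFinP; apply: measurable_maxr => //; exact: measurableT_comp.
    - exact: measurable_int iB.
    apply: filterS m2_gt0 => xy mxy _; rewrite lnr// -EFinD lee_fin.
    have := ler_norm (ln (m xy.2)).
    have := normr_ge0 (ln (m xy.2)).
    by case: (leP (- (ln (m xy.2) + s xy))%R 0%R); case: (leP (- s xy)%R 0%R); lra.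
  have [_] := integrableP _ _ _ iB.
  congr (_ < _); apply: eq_integral => xy _; rewrite gee0_abs//; exact: B0.
have gap := potential_gap ineg.
have [Doo|] := eqVneq (\int[tau]_zy (D zy.1 zy.2)%:E) +oo.
  by rewrite Doo addey ?leey// -ltNye ltNye_eq integrable_fin_num.
rewrite -ltey => Doo.
have ipos : pimu.-integrable setT (fun xy => (Num.max (s xy) 0)%:E).
  apply/integrableP; split.
    by apply/measurable_EFinP; apply: measurable_maxr.
  under eq_integral do rewrite gee0_abs ?lee_fin ?le_max ?lexx ?orbT//.
  apply: le_lt_trans gap _; rewrite lte_add_pinfty//.
  by rewrite ltey_eq integrable_fin_num.
have -> : \int[pimu]_xy (ln (r xy))%:E = \int[mu]_y (ln (m y))%:E +
    (\int[pimu]_xy (Num.max (s xy) 0)%:E - \int[pimu]_xy (Num.max (- s xy) 0)%:E).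
  rewrite -integralB//.
  have -> : \int[mu]_y (ln (m y))%:E = \int[pimu]_xy (ln (m xy.2))%:E.
    rewrite integralE [RHS]integralE; congr (_ - _).
    - rewrite -(coupling_integral2 pimu_coupling (measurable_funepos mlnm))//.
      by apply: eq_integral => xy _; rewrite !funeposE.
    - rewrite -(coupling_integral2 pimu_coupling (measurable_funeneg mlnm))//.
      by apply: eq_integral => xy _; rewrite !funenegE.
  have iB := integrableB measurableT ipos ineg.
  rewrite -integralD//; apply: ae_eq_integral => //.
    exact: measurable_int (integrableD measurableT ilnm2 iB).
  apply: filterS m2_gt0 => xy mxy _; rewrite lnr// -EFinB -EFinD; congr EFin.
  by case: (leP (s xy) 0%R); case: (leP (- s xy)%R 0%R); lra.
rewrite leeD2l// leeBlDr//; exact: integrable_fin_num.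
Qed.

End potential_gap.

(** * The support of a probability measure on a Polish space *)

Lemma probability_ae_ex (R : realType) d (T : measurableType d)
    (P : probability T R) (Q : T -> Prop) :
  {ae P, forall x, Q x} -> exists x, Q x.
Proof.
apply: (@filter_ex _ _ (ae_properfilter_algebraOfSetsType _)).
by have := @lte01 R; rewrite -(probability_setT P).
Qed.

Section support.
Context (R : realType) (X : ptopologicalType) (rho : probability (borel X) R).

(** A separable metric space has a countable base of balls; the complement of
    the support is covered by the null balls of this base. *)
Lemma polish_ae_support : polish R X -> {ae rho, forall x, msupport rho x}.
Proof.
move=> [[D cD dD] [dist [dist0 distC distT distN _]]].
pose B p n := [set y | dist p y < n.+1%:R^-1] : set X.
have oB p n : open (B p n).
  rewrite openE => y /= py; apply/distN; exists (n.+1%:R^-1 - dist p y).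
    by rewrite subr_gt0.
  by move=> z /= yz; rewrite /B /= (le_lt_trans (distT p y z))// addrC -ltrBrDr.
have mB p n : measurable (B p n : set (borel X)) by exact: sub_sigma_algebra.
have dist_gt0 x y : 0 <= dist x y.
  by have := distT x y x; rewrite (distC y x) (dist0 x x).2//; lra.
(* radius [1 / (n + 1)] below half of that of a null ball around [x] *)
have cover x : ~ msupport rho x ->
    exists2 p, D p & exists2 n, rho (B p n) = 0%E & B p n x.
  move=> /existsNP[U /not_implyP[oU /not_implyP[Ux /negP]]].
  rewrite -leNgt => rhoU.
  have /distN[e e0 eU] : nbhs x U by exact: open_nbhs_nbhs.
  have [n ne] : exists n, n.+1%:R^-1 < e / 2.
    have e20 : 0 < e / 2 by rewrite divr_gt0.
    by have [n _ /(_ _ (leqnn n))] := near_infty_natSinv_lt (PosNum e20); exists n.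
  have [p [Bxp Dp]] : B x n `&` D !=set0.
    by apply: dD => //; exists x; rewrite /B /= (dist0 x x).2.
  exists p => //; exists n; last by rewrite /B /= distC.
  apply/eqP; rewrite eq_le measure_ge0 andbT; apply: le_trans rhoU.
  apply: le_measure; rewrite ?inE//; first exact: sub_sigma_algebra.
  move=> y py; apply: eU => /=; rewrite (le_lt_trans (distT x p y))//.
  by move: Bxp py ne; rewrite /B /=; move: (n.+1%:R^-1) => t; lra.
have [q qD] : exists q : nat -> X, D `<=` range q.
  have [->|[h]] := pfcard_geP cD; first by exists (cst point).
  by exists h; exact: surj.
pose F i := \bigcup_n (if rho (B (q i) n) == 0%E then B (q i) n else set0).
apply: (@negligibleS _ _ _ rho (\bigcup_i F i)); last first.
  apply: negligible_bigcup => i; apply: negligible_bigcup => n.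
  case: ifPn => [/eqP B0|_]; last exact: negligible_set0.
  by exists (B (q i) n); split.
move=> x /cover[p /qD[i _ <-] [n B0 Bx]].
by exists i => //; exists n => //; rewrite B0 eqxx.
Qed.

End support.

(** * Gibbs densities *)

Section gibbs_density.
Local Open Scope ereal_scope.
Context (R : realType) d1 d2 (X : measurableType d1) (Y : measurableType d2).
Context (c : X -> Y -> R) (eps : R) (rho : probability X R).
Hypothesis eps_gt0 : (0 < eps)%R.
Hypothesis mc : measurable_fun setT (fun xy : X * Y => c xy.1 xy.2).

(** Replacing infinite potentials by the default value of [fine] keeps the density
    positive everywhere; it agrees with [gibbs] where both potentials are
    finite, which is almost everywhere. *)
Definition real_gibbs (phi : X -> \bar R) (psi : Y -> \bar R) (xy : X * Y) : R :=
  expR (- ((c xy.1 xy.2 + fine (phi xy.1) + fine (psi xy.2)) / eps)).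

Lemma gibbs_fin_num phi psi x y : phi x \is a fin_num -> psi y \is a fin_num ->
  gibbs c eps phi psi x y = (real_gibbs phi psi (x, y))%:E.
Proof.
rewrite /gibbs /real_gibbs /=.
by case: (phi x) (psi y) => [a| |] [b| |].
Qed.

Lemma gibbs_phi_pinfty phi psi x y : phi x = +oo -> psi y != -oo ->
  gibbs c eps phi psi x y = 0.
Proof.
move=> phix psiy; rewrite /gibbs phix addey// addye//.
by rewrite gt0_mulye ?lte_fin ?invr_gt0.
Qed.

Lemma gibbs_psi_pinfty phi psi x y : psi y = +oo -> phi x != -oo ->
  gibbs c eps phi psi x y = 0.
Proof.
move=> psiy phix; rewrite /gibbs psiy addey; last first.
  by case: (phi x) phix.
by rewrite gt0_mulye ?lte_fin ?invr_gt0.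
Qed.

Lemma measurable_real_gibbs phi psi : measurable_fun setT phi ->
  measurable_fun setT psi -> measurable_fun setT (real_gibbs phi psi).
Proof.
move=> mphi mpsi; apply: (measurableT_comp (@measurable_expR R)).
apply: measurableT_comp => //; apply: measurable_funM => //.
apply: measurable_funD; [apply: measurable_funD => //|].
- by apply: (measurableT_comp (@fine_measurable R setT measurableT)); exact: measurableT_comp.
- by apply: (measurableT_comp (@fine_measurable R setT measurableT)); exact: measurableT_comp.
Qed.

Lemma product_coupling (nu : probability Y R) : coupling rho nu (rho \x nu).
Proof.
split=> A mA; rewrite [LHS]product_measure1E//.
- by rewrite [X in _ * X]probability_setT mule1.
- by rewrite [X in X * _]probability_setT mul1e.
Qed.

Context (nu : probability Y R) (pi : probability (X * Y)%type R).
Context (phi : X -> \bar R) (psi : Y -> \bar R).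
Hypothesis pi_coupling : coupling rho nu pi.
Hypothesis potentials : entropic_potentials c eps rho nu pi phi psi.

Let pi_integral A : measurable A ->
  (forall xy, A xy -> gibbs c eps phi psi xy.1 xy.2 = 0) -> pi A = 0.
Proof.
case: potentials => _ _ [dom rnE] _ _ mA A0.
have -> : pi A = \int[(rho \x nu : probability (X * Y)%type R)]_(xy in A)
      rn_density pi (rho \x nu) xy.
  by rewrite -Radon_Nikodym_integral.
rewrite (ae_eq_integral (cst 0))//.
- exact: integral0.
- apply: measurable_funTS; apply: (measurable_int (rho \x nu : probability (X * Y)%type R)).
  exact: Radon_Nikodym_integrable.
- by apply: filterS rnE => xy /(_ Logic.I) -> /A0.
Qed.

(** The Gibbs density vanishes where a potential is infinite, so the plan, hence
    its marginal, gives no mass to such points. *)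
Lemma potential1_fin_num : {ae rho, forall x, phi x \is a fin_num}.
Proof.
case: (potentials) => -[mphi mpsi] [phiNy psiNy] _ _ _.
have mS : measurable [set x | phi x = +oo].
  by rewrite (_ : [set x | _] = phi @^-1` [set +oo])// -[X in measurable X]setTI; exact: mphi.
exists [set x | phi x = +oo]; split => //.
- apply: etrans (esym (pi_coupling.1 _ mS)) _; apply: pi_integral.
    exact: measurableX.
  by move=> [x y] [/= phix _]; exact: gibbs_phi_pinfty.
- by move=> x /=; have := phiNy x; case: (phi x).
Qed.

Lemma potential2_fin_num : {ae nu, forall y, psi y \is a fin_num}.
Proof.
case: (potentials) => -[mphi mpsi] [phiNy psiNy] _ _ _.
have mS : measurable [set x | psi x = +oo].
  by rewrite (_ : [set x | _] = psi @^-1` [set +oo])// -[X in measurable X]setTI; exact: mpsi.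
exists [set x | psi x = +oo]; split => //.
- apply: etrans (esym (pi_coupling.2 _ mS)) _; apply: pi_integral.
    exact: measurableX.
  by move=> [x y] [_ /= psiy]; exact: gibbs_psi_pinfty.
- by move=> x /=; have := psiNy x; case: (psi x).
Qed.

Lemma real_gibbs_density : has_density pi (rho \x nu) (real_gibbs phi psi).
Proof.
case: (potentials) => -[mphi mpsi] _ [dom rnE] _ _.
have mG := measurable_real_gibbs mphi mpsi.
split=> // [xy|A mA]; first exact: expR_ge0.
have -> : pi A = \int[(rho \x nu : probability (X * Y)%type R)]_(xy in A)
      rn_density pi (rho \x nu) xy.
  by rewrite -Radon_Nikodym_integral.
apply: ae_eq_integral => //.
- apply: measurable_funTS; apply: (measurable_int (rho \x nu : probability (X * Y)%type R)).
  exact: Radon_Nikodym_integrable.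
- by apply: measurable_funTS; exact/measurable_EFinP.
have phif := coupling_ae1 (product_coupling nu) potential1_fin_num.
have psif := coupling_ae2 (product_coupling nu) potential2_fin_num.
apply: filterS2 rnE (filterI phif psif) => -[x y] /(_ Logic.I) /= -> [px py] _.
exact: gibbs_fin_num.
Qed.

End gibbs_density.

(** * Semiconcavity of the potential *)

Section manifold_calculus.
Context (R : realType) (d : nat) (Y : topologicalType).
Context (M : riemannian_manifold R d Y).
Implicit Types (f g : Y -> R) (y : Y).

Lemma C1_mdifferentiable f y : C1 M f -> mdifferentiable M f y.
Proof.
move=> /(_ (chart_at M y))[df _]; apply: df.
by exists y => //; exact: dom_chart_at.
Qed.

Lemma mdifferentiableB f g y : mdifferentiable M f y ->
  mdifferentiable M g y -> mdifferentiable M (fun z => f z - g z) y.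
Proof. exact: differentiableB. Qed.

Lemma gradientD f g y : mdifferentiable M f y -> mdifferentiable M g y ->
  gradient M (fun z => f z + g z) y = gradient M f y + gradient M g y.
Proof.
move=> df dg; rewrite /gradient -mulmxDl; congr (_ *m _).
apply/rowP => k; rewrite !mxE.
rewrite (_ : _ \o _ = (f \o icoord (chart_at M y)) + (g \o icoord (chart_at M y)))//.
by rewrite deriveD//; exact: diff_derivable.
Qed.

Lemma inner_coordE y (u v : 'rV[R]_d) : inner M y u v =
  \sum_k u 0 k *
    (metric (chart_at M y) (Defs.coord (chart_at M y) y) *m v^T) k 0.
Proof. by rewrite /inner /bilin -mulmxA mxE. Qed.

End manifold_calculus.

Section semiconcavity.
Local Open Scope ereal_scope.
Context (R : realType) (d : nat) (X Y : ptopologicalType).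
Context (M : riemannian_manifold R d Y) (c : X -> Y -> R) (eps Lambda : R).
Context (rho : probability (borel X) R) (phi : X -> \bar R) (psi : Y -> R).
Hypothesis eps_gt0 : (0 < eps)%R.
Hypothesis C1c : forall x, C1 M (c x).
Hypothesis ae_support : {ae rho, forall x, msupport rho x}.
Hypothesis phi_fin : {ae rho, forall x, phi x \is a fin_num}.
Hypothesis phiNy : forall x, phi x != -oo.
Hypothesis cpsi_semiconcave :
  forall x, msupport rho x -> semiconcave M Lambda (fun y => c x y + psi y)%R.

Local Notation kernel := (@real_gibbs R _ _ (borel X) (borel Y) c eps phi (EFin \o psi)).

(** [psi] is the difference of the semiconcave function [c x + psi] and the C1
    function [c x], for any [x] in the support. *)
Lemma semiconcave_potential_mdifferentiable y : mdifferentiable M psi y.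
Proof.
have [x suppx] := probability_ae_ex ae_support.
rewrite (_ : psi = fun y => (c x y + psi y - c x y)%R); last first.
  by apply/funext => z; rewrite addrAC subrr add0r.
apply: mdifferentiableB; last exact: C1_mdifferentiable.
by have [+ _] := cpsi_semiconcave suppx; apply.
Qed.

(** The function [l] is [1 / eps] times the first order term along [g] of
    [c x + psi]. Its mean under the conditional law at [y] is the pairing of the
    velocity with [gradient psi + int (gradient (c x)) K_y(dx)], which is
    zero. *)
Lemma semiconcave_gap y z g :
  rho.-integrable setT (fun x => (kernel (x, y))%:E : \bar R) ->
  \int[rho]_x (kernel (x, y))%:E = 1 ->
  (forall k : 'I_d,
    let dc := fun x => (gradient M (c x) y 0%R k)%:E
      * @gibbs _ _ _ (borel X) (borel Y) c eps phi (EFin \o psi) x y in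
    rho.-integrable setT dc /\
    (gradient M psi y 0%R k)%:E = - \int[rho]_x dc x) ->
  is_geodesic M g -> g 0%R = y -> g 1%R = z ->
  exists l : borel X -> R,
  [/\ rho.-integrable setT (fun x => (l x * kernel (x, y))%:E),
      \int[rho]_x (l x * kernel (x, y))%:E = 0 &
      {ae rho, forall x, (ln (kernel (x, y) / kernel (x, z)) <=
        l x + Lambda / (2 * eps) * rdist M z y ^+ 2)%R}].
Proof.
move=> ik k1 gradE geo g0 g1.
pose v := velocity M g 0%R.
pose w k : R := ((metric (chart_at M y) (Defs.coord (chart_at M y) y) *m v^T) k 0 / eps)%R.
pose dc k x := (gradient M (c x) y 0%R k)%:E
      * @gibbs _ _ _ (borel X) (borel Y) c eps phi (EFin \o psi) x y.
(* Where [phi] is infinite the Gibbs density vanishes but [kernel] does not: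
   dropping the gradient of the cost there makes [lE] hold for every [x], so
   that the measurability of [l * kernel] follows from that of [dc]. *)
pose l (x : borel X) : R := (\sum_k (gradient M psi y 0%R k +
  (if phi x \is a fin_num then gradient M (c x) y 0%R k else 0)) * w k)%R.
pose F k x := (w k)%:E *
  ((gradient M psi y 0%R k)%:E * (kernel (x, y))%:E + dc k x).
have lE x : (l x * kernel (x, y))%:E = \sum_k F k x.
  rewrite /l mulr_suml -sumEFin; apply: eq_bigr => k _.
  rewrite /F /dc; have [phix|phix] := boolP (phi x \is a fin_num).
    rewrite gibbs_fin_num// -(EFinM (gradient M psi y 0%R k)).
    rewrite -(EFinM (gradient M (c x) y 0%R k)) -EFinD -(EFinM (w k)).
    by congr EFin; ring.
  rewrite gibbs_phi_pinfty//; last by move: phix (phiNy x); case: (phi x).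
  rewrite mule0 adde0 -(EFinM (gradient M psi y 0%R k)) -(EFinM (w k)).
  by congr EFin; ring.
have iF k : rho.-integrable setT (F k).
  apply: integrableZl => //; apply: integrableD => //.
    exact: integrableZl.
  exact: (gradE k).1.
have F0 k : \int[rho]_x F k x = 0.
  have i1 : rho.-integrable setT
      (fun x => (gradient M psi y 0%R k)%:E * (kernel (x, y))%:E).
    exact: integrableZl.
  have [i2 GE] := gradE k.
  rewrite integralZl//; last exact: integrableD.
  rewrite integralD// integralZl// k1 mule1 GE /dc addeC subee ?mule0//.
  exact: integrable_fin_num.
exists l; split.
- by under eq_fun do rewrite lE; exact: integrable_sum.
- under eq_integral do rewrite lE.
  by rewrite integral_sum// big1.
apply: (@filterS2 (borel X) _ _ _ _ _ _ ae_support phi_fin) => x suppx phix.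
have [dh] := cpsi_semiconcave suppx => /(_ _ _ _ geo g0 g1).
rewrite gradientD; [|exact: C1_mdifferentiable|exact: semiconcave_potential_mdifferentiable].
rewrite -/v inner_coordE => h.
have -> : ln (kernel (x, y) / kernel (x, z)) =
    ((c x z + psi z - (c x y + psi y)) / eps)%R.
  by rewrite /real_gibbs /= -expRN -expRD expRK; field; rewrite gt_eqF.
rewrite ler_pdivrMr//; apply: le_trans h _; rewrite mulrDl lerD//; last first.
  by rewrite le_eqVlt; apply/orP; left; apply/eqP; field; rewrite gt_eqF.
rewrite /l phix mulr_suml le_eqVlt; apply/orP; left; apply/eqP.
by apply: eq_bigr => k _; rewrite mxE /w; field; rewrite gt_eqF.
Qed.

End semiconcavity.

(** * Stability of entropic plans *)

Theorem mainTheorem1 (R : realType) (d : nat) (X Y : ptopologicalType)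
    (M : riemannian_manifold R d Y)
    (c : X -> Y -> R) (eps : R)
    (rho : probability (borel X) R) (nu mu : probability (borel Y) R)
    (pinu pimu : probability (borel X * borel Y)%type R)
    (phinu phimu : X -> \bar R) (psinu psimu : Y -> \bar R) (Lambda : R) :
  polish R X ->
  connected [set: Y] -> geodesic_manifold M ->
  0 < eps ->
  measurable_fun setT
    (fun xy : (borel X * borel Y)%type => c xy.1 xy.2) ->
  @unique_eot_plan R _ _ (borel X) (borel Y) c eps rho nu pinu ->
  @unique_eot_plan R _ _ (borel X) (borel Y) c eps rho mu pimu ->
  @entropic_potentials R _ _ (borel X) (borel Y) c eps rho nu pinu phinu psinu ->
  @entropic_potentials R _ _ (borel X) (borel Y) c eps rho mu pimu phimu psimu ->
  (forall x, C1 M (c x)) ->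
  weak_gradient_identity M c eps rho nu phinu psinu ->
  0 < Lambda ->
  (forall x, msupport rho x ->
     esemiconcave M Lambda (fun y => ((c x y)%:E + psinu y)%E)) ->
  (relative_entropy pimu pinu <=
   relative_entropy mu nu
   + (Lambda / (2 * eps))%:E * wasserstein2_sq M mu nu)%E.
Proof.
move=> polX _ geoM eps0 mc [pinu_cpl _] [pimu_cpl _] potnu potmu C1c wgi Lambda0 semi.
have supp := polish_ae_support rho polX.
have W0 : (0 <= wasserstein2_sq M mu nu)%E.
  apply: le_ereal_inf_tmp => _ [tau _ <-].
  by apply: integral_ge0 => zy _; rewrite lee_fin sqr_ge0.
have kap0 : 0 < Lambda / (2 * eps) by rewrite divr_gt0// mulr_gt0.
have [Hoo|] := eqVneq (relative_entropy mu nu) +oo%E.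
  rewrite Hoo addye ?leey// -ltNye (lt_le_trans (ltNyr 0))// mule_ge0//.
  by rewrite lee_fin ltW.
rewrite -ltey => Hoo.
have mu_nu : mu `<< nu.
  by move: Hoo; rewrite /relative_entropy; case: asboolP => //; rewrite ltxx.
have Hfin : relative_entropy mu nu \is a fin_num.
  have [m munu] := dominates_has_density mu_nu.
  rewrite (relative_entropy_density munu).
  apply: integrable_fin_num => //; exact: integrable_ln_density munu Hoo.
have [x0 suppx0] := probability_ae_ex supp.
pose psi := fine \o psinu.
have psinuE : psinu = EFin \o psi.
  apply/funext => y; have [h hE _] := semi _ suppx0.
  by rewrite /psi /=; move: (hE y); case: (psinu y).
have semi_psi x : msupport rho x ->
    semiconcave M Lambda (fun y => c x y + psi y).
  move=> /semi[h hE]; congr semiconcave; apply/funext => y.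
  by have := hE y; rewrite psinuE -EFinD => -[].
have phinu_fin := potential1_fin_num eps0 pinu_cpl potnu.
pose k := @real_gibbs R _ _ (borel X) (borel Y) c eps phinu psinu.
have k_density := real_gibbs_density eps0 mc pinu_cpl potnu.
have kmu_density := real_gibbs_density eps0 mc pimu_cpl potmu.
have [[mphinu mpsinu] [phinuNy _] _ _ _] := potnu.
have [[mphimu mpsimu] _ _ _ _] := potmu.
(* The potentials enter as the exponents of the density of [pimu] relative to
   the Gibbs kernel of [pinu]. *)
pose f (x : borel X) := (fine (phinu x) - fine (phimu x)) / eps.
pose g (y : borel Y) := (fine (psinu y) - fine (psimu y)) / eps.
have mfine := @fine_measurable R setT measurableT.
have mf : measurable_fun setT f.
  apply: measurable_funM => //; apply: measurable_funB.
  - exact: (measurableT_comp mfine).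
  - exact: (measurableT_comp mfine).
have mg : measurable_fun setT g.
  apply: measurable_funM => //; apply: measurable_funB.
  - exact: (measurableT_comp mfine).
  - exact: (measurableT_comp mfine).
have kmuE : @real_gibbs R _ _ (borel X) (borel Y) c eps phimu psimu =
    (fun xy => expR (f xy.1 + g xy.2) * k xy).
  apply/funext => xy; rewrite /k /real_gibbs -expRD; congr expR.
  by rewrite /f /g; field; rewrite gt_eqF.
rewrite kmuE in kmu_density.
have k_gt0 xy : 0 < k xy by exact: expR_gt0.
apply: (le_add_mul_ereal_inf Hfin kap0) => _ [tau tau_cpl <-].
apply: le_trans (leeD2l _ (@le_integral_lowerZl R _ _ tau _
  (fun zy => rdist M zy.1 zy.2 ^+ 2) kap0 (fun zy => sqr_ge0 _))).
apply: (relative_entropy_potential_gap k_gt0 k_density kmu_density mf mg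
  pinu_cpl pimu_cpl tau_cpl mu_nu
  (D := fun z y : borel Y => Lambda / (2 * eps) * rdist M z y ^+ 2)).
  by move=> z y; rewrite mulr_ge0 ?sqr_ge0// ltW.
have mass := conditional_mass1 k_gt0 k_density pinu_cpl.
have [G [_ Ggrad Gae]] := wgi.
apply: (@filterS2 (borel Y) _ _ _ _ _ _ Gae mass) => y Gy k1 z.
have [gam [geo gam0 gam1]] := geoM y z.
have mk : measurable_fun setT (fun x : borel X => k (x, y)).
  by case: k_density => mk _ _; apply: (measurableT_comp mk); exact: pair2_measurable.
have ik : rho.-integrable setT (fun x : borel X => (k (x, y))%:E).
  apply/integrableP; split; first exact/measurable_EFinP.
  under eq_integral do rewrite gee0_abs ?lee_fin ?ltW//.
  by rewrite k1 ltry.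
move: ik k1 Gy; rewrite /k psinuE => ik k1 Gy.
apply: (semiconcave_gap eps0 C1c supp phinu_fin phinuNy semi_psi ik k1 _ geo gam0 gam1).
move=> kk; have := Gy kk; rewrite Ggrad ?psinuE//.
have -> : fine \o (EFin \o psi) = psi by apply/funext.
exact: (semiconcave_potential_mdifferentiable C1c supp semi_psi).
Qed.
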